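(* Property (VRC) is stable under taking amalgamated free products over virtually cyclic subgroups. That is, if $G=G_1*_{G_0}G_2$ is an amalgamated free product of groups $G_1$ and $G_2$ over a common virtually cyclic subgroup $G_0$, and both $G_1$ and $G_2$ have property (VRC), then $G$ has property (VRC).
   Context: A subgroup $H$ of a group $G$ is a virtual retract of $G$ if there are a finite index subgroup $K\leqslant G$ containing $H$ and a homomorphism $\rho:K\to H$ with $\rho|_H=\mathrm{Id}_H$. A group $G$ has property (VRC) if every cyclic subgroup of $G$ is a virtual retract of $G$. A group is virtually cyclic if it has a cyclic subgroup of finite index (finite groups are included). *)

(* Defs.v *)
From HB Require Import structures.
From mathcomp Require Import all_boot.
From mathcomp Require Import boolp classical_sets functions cardinality.

Set Implicit Arguments.
Unset Strict Implicit.
Unset Printing Implicit Defensive.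

Import Algebra.

Local Open Scope classical_set_scope.
Local Open Scope group_scope.

Section Subgroups.
Variable G : groupType.
Implicit Types (g : G) (H K : set G).

Definition subgroup H : Prop := group_closed [in H].

Definition left_coset H g : set G := [set g * h | h in H].

Definition finite_index H : Prop := finite_set (range (left_coset H)).

Definition cyclic_subgroup g : set G :=
  [set x | exists n : nat, x = g ^+ n \/ x = g ^- n].

(* Only the values of rho on K matter: its restriction to K is a homomorphism
   from K to H. *)
Definition virtual_retract H : Prop :=
  subgroup H /\
  exists K : set G,
    [/\ subgroup K, finite_index K, H `<=` K &
      exists rho : G -> G,
        [/\ forall x, K x -> H (rho x),
            forall x y, K x -> K y -> rho (x * y) = rho x * rho y &
            forall x, H x -> rho x = x]].

End Subgroups.

Definition VRC (G : groupType) : Prop :=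
  forall g : G, virtual_retract (cyclic_subgroup g).

Definition virtually_cyclic (G : groupType) : Prop :=
  exists g : G, finite_index (cyclic_subgroup g).

Notation group_hom G H := (UMagmaMorphism.type G H).

(* G, with the maps j1 and j2, is the pushout of the monomorphisms i1 and i2
   in the category of groups. *)
Definition is_amalgamated_product (G0 G1 G2 G : groupType)
    (i1 : group_hom G0 G1) (i2 : group_hom G0 G2)
    (j1 : group_hom G1 G) (j2 : group_hom G2 G) : Prop :=
  [/\ injective i1, injective i2, j1 \o i1 =1 j2 \o i2 &
    forall (T : groupType) (f1 : group_hom G1 T) (f2 : group_hom G2 T),
      f1 \o i1 =1 f2 \o i2 ->
      exists f : group_hom G T,
        [/\ f \o j1 =1 f1, f \o j2 =1 f2 &
          forall f' : group_hom G T,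
            f' \o j1 =1 f1 -> f' \o j2 =1 f2 -> f' =1 f]].

(* Main.v *)
(* For g of infinite order, <g> is a virtual retract as soon as some homomorphism
   from a finite-index subgroup K containing g to Z does not vanish at g; for this
   it suffices that the group acts on some X * Z with X finite, commuting with the
   translations of Z, in such a way that a power of g translates a fibre {x} * Z
   nontrivially.  For g of finite order it suffices that some finite-index subgroup
   meets <g> trivially.

   Let <c> have finite index in G0, with c = 1 or c of infinite order.  Property
   (VRC) yields finite quotients p1 : G1 -> Q1 and p2 : G2 -> Q2 whose kernels meet
   G0 in the same subgroup <c0>, c0 a power of c, and which keep finitely many given
   elements away from G0.  Left translations make G1 and G2 act on Q1 * Q2 through
   one factor each; both restrict to free actions of G0 / <c0>, hence become equal
   after a G0-equivariant bijection, and G acts on Q1 * Q2.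

   - If a in G1 has infinite order, homomorphisms ker p_i -> Z not vanishing at a
     power of a, resp. at c0, induce cocycles alpha_i on Q_i.  With the weights
     alpha_2(c0, y) alpha_1(., x) and alpha_1(c0, x) alpha_2(., y) at (x, y), the
     restrictions to c0 agree, so the two actions on Q1 * Q2 * Z are again glued.
   - If g = a_0 b_0 ... a_(n-1) b_(n-1) is cyclically reduced, take n copies of
     Q1 * Q2 and a G0-equivariant bijection such that g follows a closed path
     through 2n distinct G0-orbits; weighting one of them makes g act as a
     translation by 1 over the base point. *)
From HB Require Import structures.
Require Import Defs.
From mathcomp Require Import all_boot fingroup perm cyclic all_algebra.
From mathcomp Require Import boolp classical_sets functions cardinality.
From mathcomp Require Import ring zify.

Set Implicit Arguments.
Unset Strict Implicit.
Unset Printing Implicit Defensive.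

Import Algebra GRing.Theory Num.Theory.

Local Open Scope classical_set_scope.
Local Open Scope group_scope.

(** * Finite-index subgroups *)

Lemma group_homP (G H : groupType) (f : G -> H) :
  {morph f : x y / x * y} -> exists F : group_hom G H, F =1 f.
Proof.
move=> fM.
have f1 : f 1 = 1 by apply: (mulgI (f 1)); rewrite -fM !mulg1.
have fV x : f x^-1 = (f x)^-1.
  by apply: (mulgI (f x)); rewrite -fM !mulgV f1.
have fF : {morph f : x y / x / y} by move=> x y; rewrite fM fV.
pose c := isGroupMorphism.Build G H f fF.
pose F : group_hom G H := HB.pack f c.
by exists F.
Qed.

Lemma hom_comp (G H K : groupType) (f : group_hom G H) (g : group_hom H K) :
  exists F : group_hom G K, F =1 g \o f.
Proof. by apply: group_homP => x y /=; rewrite !gmulfM. Qed.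

Section FiniteIndex.
Variable G : groupType.
Implicit Types (g h : G) (H K M : set G).

Lemma subgroupP H :
  subgroup H <-> [/\ H 1, forall x y, H x -> H y -> H (x * y) &
                     forall x, H x -> H x^-1].
Proof.
split=> [[H1 HF]|[H1 HM HV]].
  have {}H1 : H 1 by have := H1; rewrite inE.
  have {}HF x y : H x -> H y -> H (x / y).
    by move=> Hx Hy; have := HF x y; rewrite !inE => /(_ Hx Hy).
  have HV x : H x -> H x^-1 by move=> Hx; rewrite -div1g; apply: HF.
  by split=> // x y Hx Hy; rewrite -[y]invgK; apply: HF => //; apply: HV.
split; first by rewrite inE.
by move=> x y; rewrite !inE => Hx Hy; apply: HM => //; apply: HV.
Qed.

Lemma left_coset_eq H g h :
  subgroup H -> left_coset H g = left_coset H h <-> H (g^-1 * h).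
Proof.
move=> /subgroupP[H1 HM HV]; split=> [e|Hgh].
  have : left_coset H h h by exists 1; rewrite ?mulg1.
  by rewrite -e => -[k Hk <-]; rewrite mulKg.
apply/seteqP; split=> _ [k Hk <-].
  exists (h^-1 * g * k); last by rewrite !mulgA mulgV mul1g.
  by apply: HM => //; have := HV _ Hgh; rewrite invgM invgK.
by exists (g^-1 * h * k); [apply: HM|rewrite !mulgA mulgV mul1g].
Qed.

Lemma finite_index_map (T : finType) (F : G -> T) H :
    subgroup H -> (forall g h, F g = F h -> H (g^-1 * h)) -> finite_index H.
Proof.
move=> sH FH.
pose P t : set (set G) := [set A | exists2 g, F g = t & A = left_coset H g].
apply: (@sub_finite_set _ _ (\bigcup_(t in [set: T]) P t)).
  by move=> _ [g _ <-]; exists (F g) => //; exists g.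
apply: bigcup_finite => // t _.
have [[g Fg]|nP] := pselect (exists g, F g = t).
  apply: (@sub_finite_set _ _ [set left_coset H g]) => //.
  move=> _ [h Fh ->]; apply/left_coset_eq => //.
  by apply: FH; rewrite Fg Fh.
apply: (@sub_finite_set _ _ set0) => // A [g Fg _].
by case: nP; exists g.
Qed.

Definition fi_subgroup H := subgroup H /\ finite_index H.

Lemma finite_index_reps H : subgroup H -> finite_index H ->
  exists r : seq G, forall g, exists2 h, h \in r & H (h^-1 * g).
Proof.
move=> sH /finite_seqP[s es].
have repr A : A \in s -> exists h, left_coset H h = A.
  move=> As; have : [set` s] A by [].
  by rewrite -es => -[h _ <-]; exists h.
pose f A := if pselect (exists h, left_coset H h = A) is left e
            then projT1 (cid e) else 1.
exists [seq f A | A <- s] => g.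
have gs : left_coset H g \in s.
  have : range (left_coset H) (left_coset H g) by exists g.
  by rewrite es.
exists (f (left_coset H g)); first exact: map_f.
apply/left_coset_eq => //; rewrite /f.
by case: pselect => [e|[]]; [case: (cid e)|exact: repr].
Qed.

Lemma ker_fi (Q : finGroupType) (p : group_hom G Q) :
  fi_subgroup [set g | p g = 1].
Proof.
have sH : subgroup [set g | p g = 1].
  apply/subgroupP; split=> /=; first exact: gmulf1.
    by move=> x y ex ey; rewrite gmulfM ex ey mulg1.
  by move=> x ex; rewrite gmulfV ex invg1.
split=> //; apply: (finite_index_map (F := p)) => // g h e /=.
by rewrite gmulfM gmulfV e mulVg.
Qed.

(* [M] need not be normal, so [pi] is the action on its left cosets and the
   kernel is the normal core. *)
Lemma core_hom M : fi_subgroup M ->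
  exists (Q : finGroupType) (p : group_hom G Q),
    forall h, p h = 1 <-> forall g, M (g^-1 * h * g).
Proof.
move=> [sM /finite_seqP[s es]].
pose X := seq_sub s.
have actP (g : G) (A : X) : [set g^-1 * x | x in ssval A] \in s.
  have : [set` s] (ssval A) by apply: ssvalP.
  rewrite -es => -[h _ eA].
  have : range (left_coset M) (left_coset M (g^-1 * h)) by exists (g^-1 * h).
  rewrite es /= => h_in.
  suff -> : [set g^-1 * x | x in ssval A] = left_coset M (g^-1 * h) by [].
  rewrite -eA; apply/seteqP; split=> [_ [_ [k Mk <-] <-]|_ [k Mk <-]].
    by exists k; rewrite ?mulgA.
  by exists (h * k); [exists k|rewrite mulgA].
(* Translating by [g^-1] gives a right action, matching the left-to-right composition of
   permutations. *)
pose act g (A : X) : X := SeqSub (actP g A).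
have actE g A : ssval (act g A) = [set g^-1 * x | x in ssval A] by [].
have actM g h A : act (g * h) A = act h (act g A).
  apply: val_inj => /=; apply/seteqP; split=> [_ [x Ax <-]|_ [_ [x Ax <-] <-]].
    by exists (g^-1 * x); [exists x|rewrite invgM mulgA].
  by exists x; rewrite // invgM mulgA.
have act1 A : act 1 A = A.
  apply: val_inj => /=; apply/seteqP; split=> [_ [x Ax <-]|x Ax].
    by rewrite invg1 mul1g.
  by exists x; rewrite // invg1 mul1g.
have act_inj g : injective (act g).
  by apply: (can_inj (g := act g^-1)) => A; rewrite -actM mulgV act1.
have [|p pE] := @group_homP G {perm X} (fun g => perm (@act_inj g)).
  by move=> g h; apply/permP => A; rewrite permM !permE actM.
exists {perm X}, p => h; rewrite pE; split=> [e g|Mh].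
  have gs : left_coset M g \in s.
    have : range (left_coset M) (left_coset M g) by exists g.
    by rewrite es.
  have : perm (@act_inj h) (SeqSub gs) = SeqSub gs by rewrite e perm1.
  rewrite permE => /(congr1 (fun A : X => ssval A)) /= e'.
  have : left_coset M g g by exists 1; rewrite ?mulg1 //; case/subgroupP: sM.
  rewrite -e' => -[_ [k Mk <-] eg].
  have -> : h = g * k * g^-1.
    by apply: (mulgI h^-1); rewrite mulVg !mulgA -[h^-1 * g * k]mulgA eg mulgV.
  by rewrite !mulgA mulVg mul1g mulgVK.
apply/permP => A; rewrite permE perm1; apply: val_inj => /=.
have : [set` s] (ssval A) by apply: ssvalP.
rewrite -es => -[g _ <-]; apply/seteqP.
have [M1 MM MV] := (subgroupP M).1 sM.
split=> [_ [_ [k Mk <-] <-]|_ [k Mk <-]].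
  exists (g^-1 * h^-1 * g * k); last by rewrite !mulgA mulgV mul1g.
  by apply: MM => //; have := MV _ (Mh g); rewrite !invgM invgK !mulgA.
exists (h * g * k); last by rewrite !mulgA mulVg mul1g.
by exists (g^-1 * h * g * k); [apply: MM|rewrite !mulgA mulgV mul1g].
Qed.

Lemma fi_hom M : fi_subgroup M ->
  exists (Q : finGroupType) (p : group_hom G Q), forall h, p h = 1 -> M h.
Proof.
move=> /core_hom[Q [p pE]]; exists Q, p => h /pE /(_ 1).
by rewrite invg1 mul1g mulg1.
Qed.

Lemma fi_supset M H : fi_subgroup M -> subgroup H -> M `<=` H -> fi_subgroup H.
Proof.
move=> /fi_hom[Q [p pM]] sH MH; split=> //.
apply: (finite_index_map (F := p)) => // g h e; apply: MH; apply: pM.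
by rewrite gmulfM gmulfV e mulVg.
Qed.

Lemma fiI M H : fi_subgroup M -> fi_subgroup H -> fi_subgroup (M `&` H).
Proof.
move=> fM fH.
have [Q [p pM]] := fi_hom fM; have [Q' [p' pH]] := fi_hom fH.
have [[M1 MM MV] [H1 HM HV]] := ((subgroupP M).1 fM.1, (subgroupP H).1 fH.1).
have sMH : subgroup (M `&` H).
  apply/subgroupP; split=> // [x y [Mx Hx] [My Hy]|x [Mx Hx]].
    by split; [apply: MM|apply: HM].
  by split; [apply: MV|apply: HV].
split=> //; apply: (finite_index_map (F := fun g => (p g, p' g))) => //.
move=> g h [e e']; split; [apply: pM|apply: pH].
  by rewrite gmulfM gmulfV e mulVg.
by rewrite gmulfM gmulfV e' mulVg.
Qed.

Lemma fiT : fi_subgroup [set: G].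
Proof.
have sT : subgroup [set: G] by apply/subgroupP.
by split=> //; apply: (finite_index_map (F := fun=> tt)).
Qed.

Definition zhom_on K (phi : G -> int) :=
  forall x y, K x -> K y -> phi (x * y) = (phi x + phi y)%R.

Lemma zhom1 K phi : subgroup K -> zhom_on K phi -> phi 1 = 0%R.
Proof.
move=> /subgroupP[K1 _ _] /(_ 1 1 K1 K1); rewrite mulg1 => /esym/eqP.
by rewrite -subr_eq0 addrK => /eqP.
Qed.

Lemma zhomV K phi x : subgroup K -> zhom_on K phi -> K x ->
  phi x^-1 = (- phi x)%R.
Proof.
move=> sK pK Kx; have [K1 KM KV] := (subgroupP K).1 sK.
by apply: (addrI (phi x)); rewrite -pK ?mulgV ?subrr ?(zhom1 sK pK) //; apply: KV.
Qed.

Lemma zhomXn K phi x n : subgroup K -> zhom_on K phi -> K x ->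
  K (x ^+ n) /\ phi (x ^+ n) = (phi x *+ n)%R.
Proof.
move=> sK pK Kx; have [K1 KM KV] := (subgroupP K).1 sK.
elim: n => [|n [Kn e]]; first by rewrite expg0 (zhom1 sK pK).
by rewrite expgS; split; [apply: KM|rewrite pK // e mulrS].
Qed.

(** A relative form of [finite_index_map]: an element is coded by the representative of its
    [K]-coset and the value of [F] on the remaining factor, which lies in [K]. *)
Lemma fi_subgroup_rel (T : finType) (F : G -> T) K H :
    fi_subgroup K -> subgroup H ->
    (forall x y, K x -> K y -> F x = F y -> H (x^-1 * y)) -> fi_subgroup H.
Proof.
move=> [sK iK] sH FH; have [s sP] := finite_index_reps sK iK.
split=> //; pose rep g := projT1 (cid2 (sP g)).
have rep_s g : rep g \in s by rewrite /rep; case: cid2.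
have repK g : K ((rep g)^-1 * g) by rewrite /rep; case: cid2.
pose S := seq_sub s.
pose F' g : S * T := (SeqSub (rep_s g), F ((rep g)^-1 * g)).
apply: (finite_index_map (F := F')) => // g h [e e'] /=.
have -> : g^-1 * h = ((rep g)^-1 * g)^-1 * ((rep h)^-1 * h).
  by rewrite -e invgM invgK -!mulgA mulVKg.
exact: FH.
Qed.

Lemma zhom_fi K phi (r : nat) : fi_subgroup K -> zhom_on K phi -> (0 < r)%N ->
  fi_subgroup [set x | K x /\ (r %| phi x)%Z].
Proof.
move=> fK pK r0.
have sK := fK.1; have [K1 KM KV] := (subgroupP K).1 sK.
apply: (fi_subgroup_rel
  (F := fun x => Ordinal (ltn_pmod (absz (phi x %% r)%Z) r0)) fK).
  apply/subgroupP; split=> /= [|x y [Kx rx] [Ky ry]|x [Kx rx]].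
  - by rewrite (zhom1 sK pK).
  - by split; [apply: KM|rewrite pK // rpredD].
  - by split; [apply: KV|rewrite (zhomV sK pK) // rpredN].
move=> x y Kx Ky [e].
have {}e : (phi x = phi y %[mod r])%Z.
  have rz : Posz r != 0%R by rewrite -lt0n.
  have bnd z : (0 <= z %% r < r)%Z%R by rewrite modz_ge0 // ltz_pmod.
  move: e (bnd (phi x)) (bnd (phi y)) => + b b'.
  by rewrite !modn_small; lia.
split; first by apply: KM => //; apply: KV.
rewrite pK ?(zhomV sK pK) //; last exact: KV.
by rewrite addrC -eqz_mod_dvd; apply/eqP.
Qed.

End FiniteIndex.

(** * Cyclic subgroups and virtual retracts *)

Section IntegerPowers.
Variable G : groupType.
Implicit Types g h : G.

Definition zexpg g (z : int) : G :=
  match z with Posz n => g ^+ n | Negz n => g ^- n.+1 end.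

Lemma zexpg_sub g (m n : nat) : zexpg g (m%:Z - n%:Z)%R = g ^+ m / g ^+ n.
Proof.
have [le_nm|lt_mn] := leqP n m; first by rewrite -expgnFr // subzn.
have -> : (m%:Z - n%:Z = Negz (n - m).-1)%R by lia.
rewrite /= prednK ?subn_gt0 // expgnFr; last exact: ltnW.
by rewrite invgF.
Qed.

Lemma zexpgD g (y z : int) : zexpg g (y + z)%R = zexpg g y * zexpg g z.
Proof.
have subP (x : int) : exists m n : nat, x = (m%:Z - n%:Z)%R.
  by case: x => n; [exists n, 0%N|exists 0%N, n.+1]; lia.
have [m [n ->]] := subP y; have [p [q ->]] := subP z.
have -> : (m%:Z - n%:Z + (p%:Z - q%:Z) = (m + p)%N%:Z - (n + q)%N%:Z)%R by lia.
rewrite !zexpg_sub !expgnDr invgM -!mulgA; congr (_ * _).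
have : commute (g ^+ n)^-1 (g ^+ p / g ^+ q).
  apply: commuteM; last apply: commuteV.
    apply/commute_sym/commuteV/commute_sym; exact: commuteX2.
  apply/commute_sym/commuteV/commute_sym; exact: commuteX2.
by rewrite /commute !mulgA => ->.
Qed.

Lemma zexpg0 g : zexpg g 0 = 1. Proof. by []. Qed.

Lemma zexpg1 g : zexpg g 1 = g. Proof. by []. Qed.

Lemma zexpgN g (z : int) : zexpg g (- z)%R = (zexpg g z)^-1.
Proof. by apply: (mulgI (zexpg g z)); rewrite -zexpgD subrr mulgV. Qed.

Lemma zexpgM g (y z : int) : zexpg g (y * z)%R = zexpg (zexpg g y) z.
Proof.
have nat_case (n : nat) : zexpg g (y * n)%R = zexpg g y ^+ n.
  elim: n => [|n IHn]; first by rewrite mulr0.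
  by rewrite -addn1 PoszD mulrDr mulr1 zexpgD IHn addn1 expgSr.
case: z => n; first exact: nat_case.
by rewrite NegzE mulrN !zexpgN nat_case.
Qed.

Lemma zexpg1n (z : int) : zexpg (1 : G) z = 1.
Proof. by case: z => n /=; rewrite expg1n ?invg1. Qed.

Lemma zexpgJ g h (z : int) : zexpg (h * g * h^-1) z = h * zexpg g z * h^-1.
Proof.
have nat_case (n : nat) : (h * g * h^-1) ^+ n = h * g ^+ n * h^-1.
  elim: n => [|n IHn]; first by rewrite !expg0 mulg1 mulgV.
  by rewrite !expgS IHn !mulgA mulgVK.
by case: z => n /=; rewrite nat_case // !invgM invgK !mulgA.
Qed.

Lemma cyclic_subgroupE g x : cyclic_subgroup g x <-> exists z, x = zexpg g z.
Proof.
split=> [[n [->|->]]|[[n|n] ->]].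
- by exists (Posz n).
- by exists (- Posz n)%R; rewrite zexpgN.
- by exists n; left.
- by exists n.+1; right.
Qed.

Lemma cyclic_subgroup_closed g : subgroup (cyclic_subgroup g).
Proof.
apply/subgroupP; split=> [|x y|x].
- by apply/cyclic_subgroupE; exists 0%R.
- move=> /cyclic_subgroupE[y1 ->] /cyclic_subgroupE[y2 ->].
  by apply/cyclic_subgroupE; exists (y1 + y2)%R; rewrite zexpgD.
- move=> /cyclic_subgroupE[z ->].
  by apply/cyclic_subgroupE; exists (- z)%R; rewrite zexpgN.
Qed.

Definition infinite_order g := forall n : nat, g ^+ n.+1 <> 1.

Lemma zexpg_inj g : infinite_order g -> injective (zexpg g).
Proof.
move=> infg; suff zexpg_eq1 z : zexpg g z = 1 -> z = 0%R.
  move=> y z e; apply/eqP; rewrite -subr_eq0; apply/eqP/zexpg_eq1.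
  by rewrite zexpgD zexpgN e mulgV.
case: z => [[|n]|n] //= e; first by case: (infg n).
by case: (infg n); apply: invg_inj; rewrite e invg1.
Qed.

Lemma finite_or_infinite_order g :
  (exists2 n : nat, (0 < n)%N & g ^+ n = 1) \/ infinite_order g.
Proof.
have [[n e]|ninf] := pselect (exists n : nat, g ^+ n.+1 = 1); [left|right].
  by exists n.+1.
by move=> n e; case: ninf; exists n.
Qed.

Lemma zhom_zexpg (K : set G) phi g z :
  subgroup K -> zhom_on K phi -> K g ->
  K (zexpg g z) /\ phi (zexpg g z) = (phi g * z)%R.
Proof.
move=> sK pK Kg; have [_ _ KV] := (subgroupP K).1 sK.
case: z => n.
  by have [Kn e] := zhomXn n sK pK Kg; rewrite e -mulr_natr natz.
have [Kn e] := zhomXn n.+1 sK pK Kg.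
split; first exact: KV.
by rewrite (zhomV sK pK) // e NegzE mulrN -mulr_natr natz.
Qed.

End IntegerPowers.

Lemma hom_zexpg (G H : groupType) (f : group_hom G H) g z :
  f (zexpg g z) = zexpg (f g) z.
Proof. by case: z => n /=; rewrite ?gmulfV gmulfXn. Qed.

Section VirtualRetracts.
Variable G : groupType.
Implicit Types (g h c s : G) (K M : set G).

(** Where [phi g] divides [phi], the map [x |-> g ^ (phi x / phi g)] is a homomorphism fixing [<g>],
    and this divisibility cuts out a finite-index subgroup of [K]. *)
Lemma zhom_virtual_retract g K phi :
    fi_subgroup K -> zhom_on K phi -> K g -> phi g <> 0%R ->
  virtual_retract (cyclic_subgroup g).
Proof.
move=> fK pK Kg pg0; split; first exact: cyclic_subgroup_closed.
have m0 : (0 < absz (phi g))%N by rewrite absz_gt0; apply/eqP.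
have [sL iL] := zhom_fi fK pK m0.
exists [set x | K x /\ (absz (phi g) %| phi x)%Z]; split=> //.
  move=> _ /cyclic_subgroupE[z ->] /=.
  have [Kz ->] := zhom_zexpg z fK.1 pK Kg; split=> //.
  by rewrite abszE dvdz_mulr // dvdzE absz_id.
exists (fun x => zexpg g (phi x %/ phi g)%Z); split.
- by move=> x _; apply/cyclic_subgroupE; eexists.
- move=> x y [Kx dx] [Ky dy]; rewrite -zexpgD pK // divzDl //.
- move=> _ /cyclic_subgroupE[z ->].
  have [_ ->] := zhom_zexpg z fK.1 pK Kg.
  by rewrite mulKz //; apply/eqP.
Qed.

(** A finite quotient [p] with kernel in [M] is injective on [<g>]. The retraction applies [p] on
    the preimage of [p <g>], then the inverse of [p] on [<g>]. *)
Lemma separated_virtual_retract g M : fi_subgroup M ->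
    (forall z, M (zexpg g z) -> zexpg g z = 1) ->
  virtual_retract (cyclic_subgroup g).
Proof.
move=> /fi_hom[Q [p pM]] Mg; split; first exact: cyclic_subgroup_closed.
have p_inj y z : p (zexpg g y) = p (zexpg g z) -> zexpg g y = zexpg g z.
  move=> e; apply: divg1_eq; rewrite -zexpgN -zexpgD; apply/Mg/pM.
  by rewrite zexpgD zexpgN gmulfM gmulfV e mulgV.
pose K := [set h | exists z, p h = p (zexpg g z)].
have sK : subgroup K.
  apply/subgroupP; split=> [|x y [y1 e1] [y2 e2]|x [z e]].
  - by exists 0%R.
  - by exists (y1 + y2)%R; rewrite zexpgD !gmulfM e1 e2.
  - by exists (- z)%R; rewrite zexpgN !gmulfV e.
have fK : fi_subgroup K.
  apply: fi_supset (ker_fi p) sK _ => x /= e.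
  by exists 0%R; rewrite zexpg0 gmulf1.
exists K; split=> //; first exact: fK.2.
  by move=> _ /cyclic_subgroupE[z ->]; exists z.
pose rho h := zexpg g (xget 0%R [set z | p h = p (zexpg g z)]).
have rhoE h z : p h = p (zexpg g z) -> rho h = zexpg g z.
  move=> e; apply: p_inj; rewrite -e.
  by have := @xgetPex _ 0%R [set z | p h = p (zexpg g z)] (ex_intro _ _ e).
exists rho; split.
- by move=> x _; apply/cyclic_subgroupE; eexists.
- move=> x y [y1 e1] [y2 e2]; rewrite (rhoE _ _ e1) (rhoE _ _ e2) -zexpgD.
  by apply: rhoE; rewrite zexpgD !gmulfM e1 e2.
- by move=> _ /cyclic_subgroupE[z ->]; apply: rhoE.
Qed.

Lemma virtual_retractJ g h : virtual_retract (cyclic_subgroup g) ->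
  virtual_retract (cyclic_subgroup (h * g * h^-1)).
Proof.
move=> [_ [K [sK iK gK [rho [rhoH rhoM rho_id]]]]].
split; first exact: cyclic_subgroup_closed.
have [K1 KM KV] := (subgroupP K).1 sK.
pose K' := [set x | K (h^-1 * x * h)].
have sK' : subgroup K'.
  apply/subgroupP; split=> [|x y Kx Ky|x Kx]; rewrite /K' /=.
  - by rewrite mulg1 mulVg.
  - have -> : h^-1 * (x * y) * h = h^-1 * x * h * (h^-1 * y * h).
      by rewrite !mulgA mulgK.
    exact: KM.
  - have -> : h^-1 * x^-1 * h = (h^-1 * x * h)^-1.
      by rewrite !invgM invgK !mulgA.
    exact: KV.
(* The kernel of [p] lies in every conjugate of [K], in particular in [K']. *)
have [Q [p pK]] := core_hom (conj sK iK).
exists K'; split=> //.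
- suff [] : fi_subgroup K' by [].
  by apply: (fi_supset (ker_fi p) sK') => x /= /pK /(_ h).
- move=> _ /cyclic_subgroupE[z ->]; apply: gK; apply/cyclic_subgroupE.
  by exists z; rewrite zexpgJ !mulgA mulVg mul1g mulgVK.
exists (fun x => h * rho (h^-1 * x * h) * h^-1); split.
- move=> x Kx; have /cyclic_subgroupE[z ->] := rhoH _ Kx.
  by apply/cyclic_subgroupE; exists z; rewrite zexpgJ.
- move=> x y Kx Ky.
  have -> : h^-1 * (x * y) * h = h^-1 * x * h * (h^-1 * y * h).
    by rewrite !mulgA mulgK.
  by rewrite rhoM // !mulgA mulgVK.
- move=> _ /cyclic_subgroupE[z ->]; rewrite zexpgJ.
  rewrite !mulgA mulVg mul1g mulgVK rho_id //.
  by apply/cyclic_subgroupE; exists z.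
Qed.

Hypothesis GVRC : VRC G.

(** The retraction onto [<g>], read through the isomorphism of [<g>] with Z, is the required [phi];
    [xget] falls back on its default only outside [K]. *)
Lemma VRC_zhom g : infinite_order g ->
  exists K phi, [/\ fi_subgroup K, zhom_on K phi, K g & phi g = 1%R].
Proof.
move=> infg; have [_ [K [sK iK gK [rho [rhoH rhoM rho_id]]]]] := GVRC g.
pose phi x := xget 0%R [set z | rho x = zexpg g z].
have phiE x : K x -> rho x = zexpg g (phi x).
  by move=> /rhoH/cyclic_subgroupE; apply: xgetPex.
have Kg : K g by apply: gK; exists 1%N; left.
have [_ KM _] := (subgroupP K).1 sK.
exists K, phi; split=> // [x y Kx Ky|]; apply: (zexpg_inj infg).
  by rewrite zexpgD -!phiE ?rhoM //; apply: KM.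
by rewrite -phiE // rho_id // ?zexpg1 //; exists 1%N; left.
Qed.

(** [M] is the kernel of the retraction: it has finite index because [<g>] is finite, and meets
    [<g>] trivially because the retraction fixes [<g>]. *)
Lemma VRC_torsion g n : (0 < n)%N -> g ^+ n = 1 ->
  exists2 M, fi_subgroup M & forall z, M (zexpg g z) -> zexpg g z = 1.
Proof.
move=> n0 gn; have [_ [K [sK iK gK [rho [rhoH rhoM rho_id]]]]] := GVRC g.
have [K1 KM KV] := (subgroupP K).1 sK.
have rho1 : rho 1 = 1.
  by apply: (mulgI (rho 1)); rewrite -rhoM // !mulg1.
have rhoV x : K x -> rho x^-1 = (rho x)^-1.
  move=> Kx; apply: (mulgI (rho x)); rewrite -rhoM //; last exact: KV.
  by rewrite !mulgV.
exists [set x | K x /\ rho x = 1]; last first.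
  move=> z [_ e]; rewrite -[LHS]rho_id //; apply/cyclic_subgroupE; by exists z.
pose ord (z : int) := Ordinal (ltn_pmod (absz (z %% n)%Z) n0).
have ordE y z : ord y = ord z -> zexpg g y = zexpg g z.
  have rz : Posz n != 0%R by rewrite -lt0n.
  have bnd t : (0 <= t %% n < n)%Z%R by rewrite modz_ge0 // ltz_pmod.
  move: (bnd y) (bnd z) => b b' [].
  rewrite !modn_small; try by lia.
  move=> e; have {}e : (y %% n)%Z = (z %% n)%Z by lia.
  rewrite (divz_eq y n) (divz_eq z n) e !zexpgD.
  by rewrite ![((_ %/ _)%Z * _)%R]mulrC !zexpgM /= gn !zexpg1n.
pose phi x := xget 0%R [set z | rho x = zexpg g z].
have phiE x : K x -> rho x = zexpg g (phi x).
  by move=> /rhoH/cyclic_subgroupE; apply: xgetPex.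
apply: (fi_subgroup_rel (F := fun x => ord (phi x)) (conj sK iK)).
  apply/subgroupP; split=> //= [x y [Kx ex] [Ky ey]|x [Kx ex]].
    by rewrite rhoM // ex ey mulg1; split; first exact: KM.
  by rewrite rhoV // ex invg1; split; first exact: KV.
move=> x y Kx Ky /ordE; rewrite -!phiE // => e /=.
have KVx := KV _ Kx.
by rewrite rhoM // rhoV // e mulVg; split; first exact: KM.
Qed.

Lemma VRC_residually_finite g : g <> 1 -> exists2 M, fi_subgroup M & ~ M g.
Proof.
move=> g1; case: (finite_or_infinite_order g) => [[n n0 gn]|infg].
  have [M fM Mg] := VRC_torsion n0 gn; exists M => // /(Mg 1%R).
  by rewrite zexpg1.
have [K [phi [fK pK Kg pg]]] := VRC_zhom infg.
exists [set x | K x /\ (2%N %| phi x)%Z]; first exact: zhom_fi.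
by case=> _; rewrite pg.
Qed.

(** This is the separability of [<c>] in the profinite topology. For [s] in [K], it reduces to
    residual finiteness at [c ^ (- phi s) * s]. *)
Lemma VRC_cyclic_separable c s : c = 1 \/ infinite_order c ->
    ~ cyclic_subgroup c s ->
  exists2 M, fi_subgroup M & forall z, ~ M (zexpg c z * s).
Proof.
move=> [->|infc] ncs.
  have [|M fM Ms] := @VRC_residually_finite s.
    by move=> s1; apply: ncs; exists 0%N; left.
  by exists M => // z; rewrite zexpg1n mul1g.
have [K [phi [fK pK Kc pc]]] := VRC_zhom infc.
have sK := fK.1; have [K1 KM KV] := (subgroupP K).1 sK.
have Kz z : K (zexpg c z) by have [] := zhom_zexpg z sK pK Kc.
have pz z : phi (zexpg c z) = z.
  by have [_ ->] := zhom_zexpg z sK pK Kc; rewrite pc mul1r.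
have [Ks|nKs] := pselect (K s); last first.
  exists K => // z Kzs; apply: nKs.
  by rewrite -[s](mulKg (zexpg c z)); apply: KM => //; apply: KV.
have [|N fN Ny] := @VRC_residually_finite (zexpg c (- phi s)%R * s).
  move=> e; apply: ncs; apply/cyclic_subgroupE; exists (phi s).
  by apply: (mulgI (zexpg c (- phi s)%R)); rewrite e -zexpgD addNr.
have [Q [p pN]] := fi_hom fN.
have e0 : (0 < #[p c])%N by exact: order_gt0.
(* If [c ^ z * s] lies in this subgroup, the order of [p c] divides [z + phi s], so [p] is also 1 at
   [c ^ (- phi s) * s], which [N] excludes. *)
exists ([set x | p x = 1] `&` [set x | K x /\ (#[p c] %| phi x)%Z]).
  by apply: fiI; [apply: ker_fi|apply: zhom_fi].
move=> z [/= e [Kzs]]; rewrite pK // pz => /dvdzP[q eq].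
apply: Ny; apply: pN; rewrite -[RHS]e !gmulfM; congr (_ * _).
rewrite !hom_zexpg; have -> : (- phi s = z + Posz #[p c]%g * (- q))%R.
    by rewrite mulrN mulrC -eq; lia.
by rewrite zexpgD zexpgM /= expg_order zexpg1n mulg1.
Qed.

End VirtualRetracts.

(** * Compatible finite quotients *)

(** [d] is the gcd of a possibly infinite family, found as the least positive gcd of a finite
    subfamily: adjoining one more [u i] cannot lower it, so it divides [u i]. *)
Lemma gcd_family (I : Type) (u : I -> int) (i0 : I) : u i0 <> 0%R ->
  exists d : nat, [/\ (0 < d)%N, forall i, (d %| u i)%Z &
    forall r k : int, (forall i, (r %| (k * u i)%R)%Z) -> (r %| (k * d)%R)%Z].
Proof.
move=> u0; pose gl := foldr (fun i a => gcdn (absz (u i)) a) 0%N.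
pose P n := `[< (0 < n)%N /\ exists s, gl s = n >].
have exP : exists n, P n.
  exists (absz (u i0)); apply/asboolP; split; first by rewrite absz_gt0; apply/eqP.
  by exists [:: i0]; rewrite /= gcdn0.
case: (ex_minnP exP) => d /asboolP[d0 [s es]] d_min; exists d; split=> //.
  move=> i; rewrite dvdzE absz_nat; apply/gcdn_idPr.
  have gd : (gcdn (absz (u i)) d <= d)%N by rewrite dvdn_leq // dvdn_gcdr.
  apply/eqP; rewrite eqn_leq gd d_min //; apply/asboolP.
  split; first by rewrite gcdn_gt0 d0 orbT.
  by exists (i :: s); rewrite /= es.
move=> r k ru; rewrite dvdzE abszM absz_nat -es.
elim: s {es} => [|i s IHs] /=; first by rewrite muln0.
by rewrite muln_gcdr dvdn_gcd IHs andbT -abszM -dvdzE.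
Qed.

Lemma zexpg_eq1 (Q : finGroupType) (x : Q) z :
  zexpg x z = 1 <-> (Posz #[x] %| z)%Z.
Proof.
rewrite dvdzE absz_nat order_dvdn.
have -> : (zexpg x z = 1) = (zexpg x z == 1) by apply/propext; split=> /eqP.
by case: z => n //=; rewrite invg_eq1.
Qed.

(** The arbitrary factor [t] allows the kernels in two groups to be matched later. As a kernel is
    normal, all conjugates of powers of [c] are controlled at once, through the gcd [d] of the
    values of [phi] on the conjugates of [c ^ m1]. *)
Lemma VRC_exact_order (G : groupType) (c : G) M :
    VRC G -> c = 1 \/ infinite_order c -> fi_subgroup M ->
  exists2 m0 : nat, (0 < m0)%N & forall t : nat, (0 < t)%N ->
    exists (Q : finGroupType) (p : group_hom G Q),
      (forall h, p h = 1 -> M h) /\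
      forall j : int, p (zexpg c j) = 1 <->
        exists i : int, zexpg c j = zexpg c (Posz (m0 * t) * i)%R.
Proof.
move=> GVRC [->|infc] fM.
  exists 1%N => // t _; have [Q [p pM]] := fi_hom fM.
  exists Q, p; split=> // j; rewrite zexpg1n gmulf1; split=> // _.
  by exists 0%R; rewrite zexpg1n.
have [K [phi [fK pK Kc pc]]] := VRC_zhom GVRC infc.
have [Q0 [p0 p0P]] := fi_hom (fiI fK fM).
set m1 := #[p0 c].
have p0z j : p0 (zexpg c j) = 1 <-> (m1 %| j)%Z.
  by rewrite hom_zexpg; apply: zexpg_eq1.
have p0J g h : p0 h = 1 -> p0 (g^-1 * h * g) = 1.
  by move=> e; rewrite !gmulfM e mulg1 gmulfV mulVg.
have cm1 : p0 (zexpg c m1) = 1 by apply/p0z.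
pose u (g : G) := phi (g^-1 * zexpg c m1 * g).
have uz g i : p0 (g^-1 * zexpg c (Posz m1 * i)%R * g) = 1 /\
    phi (g^-1 * zexpg c (Posz m1 * i)%R * g) = (u g * i)%R.
  split; first by apply: p0J; apply/p0z; rewrite dvdz_mulr.
  have Ku : K (g^-1 * zexpg c m1 * g) by case: (p0P _ (p0J g _ cm1)).
  have [_ <-] := zhom_zexpg i fK.1 pK Ku; congr phi.
  by have := zexpgJ (zexpg c m1) g^-1 i; rewrite invgK zexpgM => ->.
have u1 : u 1 = m1.
  rewrite /u invg1 mul1g mulg1.
  by have [_ ->] := zhom_zexpg m1 fK.1 pK Kc; rewrite pc mul1r.
have [|d [d0 du dP]] := @gcd_family _ u 1.
  by rewrite u1; have := order_gt0 (p0 c); rewrite -/m1; lia.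
exists m1 => [|t t0]; first exact: order_gt0.
have dt0 : (0 < d * t)%N by rewrite muln_gt0 d0.
(* On a conjugate of [c ^ (m1 * i)], [phi] is [u g * i]; [d * t] divides all these values exactly
   when [t] divides [i]. *)
have [Q [p pP]] := core_hom (fiI (ker_fi p0) (zhom_fi fK pK dt0)).
exists Q, p; split.
  move=> h /pP /(_ 1) [/=]; rewrite invg1 mul1g mulg1 => e _.
  by case: (p0P _ e).
move=> j; split=> [/pP pj|[i /(zexpg_inj infc) ->]].
  have /dvdzP[i ej] : (m1 %| j)%Z.
    by apply/p0z; have [/=] := pj 1; rewrite invg1 mul1g mulg1.
  suff /dvdzP[q ei] : (t %| i)%Z.
    by exists q; rewrite ej ei; congr zexpg; rewrite PoszM; ring.
  have : ((d * t)%N %| (i * d)%R)%Z.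
    apply: dP => g; have [_ [_]] := pj g.
    by rewrite ej mulrC (uz g i).2 mulrC.
  by rewrite PoszM [(i * d)%R]mulrC dvdz_mul2l //; lia.
have -> : (Posz (m1 * t) * i = Posz m1 * (Posz t * i))%R by rewrite PoszM; ring.
apply/pP => g; have [e1 e2] := uz g (Posz t * i)%R.
split=> //; split; first by case: (p0P _ e1).
by rewrite e2 mulrA dvdz_mulr // PoszM dvdz_mul.
Qed.

(** Since every [u] is [h * c ^ z] with [h] in [r], finitely many separations suffice: [N] keeps
    [<c>] away from the representatives outside it and from all [h^-1 * s]. *)
Lemma VRC_compatible_quotient (C G : groupType) (i : group_hom C G) (c : C)
    (r : seq C) (M : set G) (S : seq G) :
    VRC G -> injective i -> c = 1 \/ infinite_order c ->
    (forall u, exists2 h, h \in r & cyclic_subgroup c (h^-1 * u)) ->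
    fi_subgroup M -> (forall s, s \in S -> forall u, s <> i u) ->
  exists2 m0 : nat, (0 < m0)%N & forall t : nat, (0 < t)%N ->
    exists (Q : finGroupType) (p : group_hom G Q),
      [/\ forall h, p h = 1 -> M h,
          forall u, p (i u) = 1 <-> exists k, u = zexpg c (Posz (m0 * t) * k)%R &
          forall s, s \in S -> forall u, p s <> p (i u)].
Proof.
move=> GVRC i_inj infc rP fM SP.
have infic : i c = 1 \/ infinite_order (i c).
  case: infc => [->|infc]; first by left; rewrite gmulf1.
  right=> n; rewrite -gmulfXn => e; apply: (infc n); apply: i_inj.
  by rewrite e gmulf1.
have [N fN NP] : exists2 N : set G, fi_subgroup N & forall h, h \in r ->
    (~ cyclic_subgroup (i c) (i h) -> forall z, ~ N (zexpg (i c) z * i h)) /\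
    forall s, s \in S -> forall z, ~ N (zexpg (i c) z * ((i h)^-1 * s)).
  have sepP (Y : seq G) : exists2 N : set G, fi_subgroup N & forall y,
      y \in Y -> ~ cyclic_subgroup (i c) y -> forall z, ~ N (zexpg (i c) z * y).
    elim: Y => [|y Y [N fN NY]]; first by exists [set: G]; first exact: fiT.
    have [cy|ncy] := pselect (cyclic_subgroup (i c) y).
      by exists N => // x; rewrite inE => /predU1P[->|/NY].
    have [N' fN' N'y] := VRC_cyclic_separable GVRC infic ncy.
    exists (N `&` N'); first exact: fiI.
    move=> x; rewrite inE => /predU1P[-> _ z []|xY ncx z [Nx _]].
      by move=> _ /N'y.
    exact: NY Nx.
  have [N fN NY] :=
    sepP ([seq i h | h <- r] ++ [seq (i h)^-1 * s | h <- r, s <- S]).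
  exists N => // h hr; split.
    by apply: NY; rewrite mem_cat map_f.
  move=> s sS; apply: NY; first by
    rewrite mem_cat (allpairs_f (fun h s => (i h)^-1 * s) hr sS) orbT.
  move=> /cyclic_subgroupE[z e]; apply: (SP s sS (h * zexpg c z)).
  by rewrite gmulfM hom_zexpg -e mulVKg.
have [m0 m00 mP] := VRC_exact_order GVRC infic (fiI fM fN).
exists m0 => // t t0; have [Q [p [pMN pz]]] := mP t t0.
exists Q, p; split.
- by move=> h /pMN[].
- move=> u; split=> [pu|[k ->]]; last first.
    by rewrite hom_zexpg; apply/pz; exists k.
  have [h hr /cyclic_subgroupE[z ez]] := rP u.
  have eu : u = h * zexpg c z by rewrite -ez mulVKg.
  (* If [i h] is a power of [i c], so is [i u] and the exact order applies; otherwise [N] excludes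
     [p (i u) = 1]. *)
  have [/cyclic_subgroupE[w ew]|nch] := pselect (cyclic_subgroup (i c) (i h)).
    have eiu : i u = zexpg (i c) (w + z)%R.
      by rewrite eu gmulfM hom_zexpg ew zexpgD.
    move: pu; rewrite eiu => /pz[k ek]; exists k; apply: i_inj.
    by rewrite hom_zexpg -ek.
  case: ((NP h hr).1 nch z); apply: (proj2 (pMN _ _)).
  move: pu; rewrite eu !gmulfM hom_zexpg => /mulg1_eq <-.
  by rewrite mulVg.
- move=> s sS u psu; have [h hr /cyclic_subgroupE[z ez]] := rP u.
  case: ((NP h hr).2 s sS (- z)%R); apply: (proj2 (pMN _ _)).
  rewrite !gmulfM psu -!gmulfM; have -> : u = h * zexpg c z by rewrite -ez mulVKg.
  rewrite !gmulfM gmulfV mulKg [i (zexpg _ _)]hom_zexpg.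
  by rewrite -gmulfM -zexpgD addNr gmulf1.
Qed.

(** A generator of finite order is replaced by 1: [<c>] meets some finite-index subgroup trivially,
    so the trivial subgroup has finite index in [C]. *)
Lemma infinite_or_trivial_reps (C G : groupType) (i : group_hom C G) :
    VRC G -> injective i -> virtually_cyclic C ->
  exists (c : C) (r : seq C), (c = 1 \/ infinite_order c) /\
    forall u, exists2 h, h \in r & cyclic_subgroup c (h^-1 * u).
Proof.
move=> GVRC i_inj [c ic].
have sc := cyclic_subgroup_closed c.
case: (finite_or_infinite_order c) => [[n n0 cn]|infc]; last first.
  by exists c; have [r rP] := finite_index_reps sc ic; exists r; split; [right|].
have icn : i c ^+ n = 1 by rewrite -gmulfXn cn gmulf1.
have [M fM Mc] := VRC_torsion GVRC n0 icn.
have [Q [p pM]] := fi_hom fM.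
have [q qE] := hom_comp i p.
have [sK iK] := fiI (conj sc ic) (ker_fi q).
have [r rP] := finite_index_reps sK iK.
exists 1, r; split=> [|u]; first by left.
have [h hr [/cyclic_subgroupE[z ez] /= e]] := rP u.
exists h => //; apply/cyclic_subgroupE; exists 0%R; rewrite ez; apply: i_inj.
rewrite zexpg0 gmulf1 hom_zexpg; apply: Mc; apply: pM.
by rewrite -hom_zexpg -ez -e qE.
Qed.

(** Taking [t] to be [m2] on the first side and [m1] on the second makes both kernels meet [C] in
    the powers of [c ^ (m1 * m2)]. *)
Lemma compatible_quotients (C G1 G2 : groupType)
    (i1 : group_hom C G1) (i2 : group_hom C G2)
    (M1 : set G1) (M2 : set G2) (S1 : seq G1) (S2 : seq G2) (c : C) (r : seq C) :
    VRC G1 -> VRC G2 -> injective i1 -> injective i2 ->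
    c = 1 \/ infinite_order c ->
    (forall u, exists2 h, h \in r & cyclic_subgroup c (h^-1 * u)) ->
    fi_subgroup M1 -> fi_subgroup M2 ->
    (forall s, s \in S1 -> forall u, s <> i1 u) ->
    (forall s, s \in S2 -> forall u, s <> i2 u) ->
  exists (m : nat) (Q1 Q2 : finGroupType)
    (p1 : group_hom G1 Q1) (p2 : group_hom G2 Q2),
    [/\ (0 < m)%N,
        (forall h, p1 h = 1 -> M1 h) /\ (forall h, p2 h = 1 -> M2 h),
        (forall u, p1 (i1 u) = 1 <-> exists k, u = zexpg c (Posz m * k)%R) /\
        (forall u, p2 (i2 u) = 1 <-> exists k, u = zexpg c (Posz m * k)%R),
        forall s, s \in S1 -> forall u, p1 s <> p1 (i1 u) &
        forall s, s \in S2 -> forall u, p2 s <> p2 (i2 u)].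
Proof.
move=> V1 V2 inj1 inj2 infc rP fM1 fM2 SP1 SP2.
have [m1 m10 /= P1] := VRC_compatible_quotient V1 inj1 infc rP fM1 SP1.
have [m2 m20 /= P2] := VRC_compatible_quotient V2 inj2 infc rP fM2 SP2.
have [Q1 [p1 [A1 B1 C1]]] := P1 _ m20.
have [Q2 [p2 [A2 B2 C2]]] := P2 _ m10.
exists (m1 * m2)%N, Q1, Q2, p1, p2; split=> //; first by rewrite muln_gt0 m10.
by split=> // u; rewrite mulnC.
Qed.

(** * Weighted actions *)

Section WeightedActions.
Variables (G : groupType) (X : finType).

(* [f] is an action of [G] on [X] and [w] an integer cocycle over it:
   together they form an action on [X * Z] commuting with the translations
   of Z, namely [(x, k) |-> (f g x, k + w g x)]. *)
Definition weighted_action (f : G -> X -> X) (w : G -> X -> int) : Prop :=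
  [/\ forall x, f 1 x = x,
      forall g h x, f (g * h) x = f g (f h x) &
      forall g h x, w (g * h) x = (w h x + w g (f h x))%R].

Variables (f : G -> X -> X) (w : G -> X -> int).
Hypothesis fw : weighted_action f w.

Lemma waction_inj g : injective (f g).
Proof.
have [f1 fM _] := fw; apply: (can_inj (g := f g^-1)) => x.
by rewrite -fM mulVg f1.
Qed.

Lemma waction_ker_fi H : subgroup H ->
  (forall g, (forall x, f g x = x) -> H g) -> fi_subgroup H.
Proof.
have [f1 fM _] := fw; move=> sH fH; split=> //.
apply: (finite_index_map (F := fun g => [ffun x => f g x])) => // g h e.
apply: fH => x; have /ffunP/(_ x) := e; rewrite !ffunE fM => <-.
by rewrite -fM mulVg f1.
Qed.

(** A form of transfer: [mu] counts the visits of the [g]-cycle of [x0] to each point and is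
    [g]-invariant since [g ^ n] fixes [x0]. On its stabilizer [L], the [mu]-weighted sum of [w] is a
    homomorphism to Z with value [w (g ^ n) x0] at [g]. *)
Lemma weighted_virtual_retract g n x0 :
    f (g ^+ n) x0 = x0 -> w (g ^+ n) x0 <> 0%R ->
  virtual_retract (cyclic_subgroup g).
Proof.
have [f1 fM wM] := fw.
have w1 x : w 1 x = 0%R.
  have := wM 1 1 x; rewrite mulg1 f1 => /eqP.
  by rewrite eq_sym -subr_eq0 addrK => /eqP.
case: n => [_|n fx wx]; first by rewrite expg0 w1.
pose mu x : int := (\sum_(i < n.+1) (f (g ^+ i) x0 == x)%:R)%R.
pose L := [set h | forall x, mu (f h x) = mu x].
pose lambda h := (\sum_x mu x * w h x)%R.
have sL : subgroup L.
  apply/subgroupP; split=> [x|h k Lh Lk x|h Lh x].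
  - by rewrite f1.
  - by rewrite fM Lh Lk.
  - by rewrite -(Lh (f h^-1 x)) -fM mulgV f1.
apply: (@zhom_virtual_retract _ g L lambda).
- by apply: waction_ker_fi => // h fh x; rewrite fh.
- move=> h k Lh Lk; rewrite /lambda [X in (X + _)%R](reindex_inj (@waction_inj k)).
  rewrite addrC -big_split /=; apply: eq_bigr => x _.
  by rewrite wM mulrDr Lk.
- move=> x; rewrite /mu big_ord_recl [RHS]big_ord_recr /= addrC; congr (_ + _)%R.
    by rewrite expg0 f1 -{1}fx expgS fM (inj_eq (@waction_inj g)).
  apply: eq_bigr => i _; rewrite /bump /= add1n expgS fM.
  by rewrite (inj_eq (@waction_inj g)).
suff -> : lambda g = w (g ^+ n.+1) x0 by [].
have wX m : w (g ^+ m) x0 = (\sum_(i < m) w g (f (g ^+ i) x0))%R.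
  elim: m => [|m IHm]; first by rewrite big_ord0 expg0 w1.
  by rewrite big_ord_recr /= -IHm expgS wM.
rewrite wX /lambda /mu.
under eq_bigr do rewrite mulr_suml.
rewrite exchange_big /=; apply: eq_bigr => i _.
rewrite (bigD1 (f (g ^+ i) x0)) //= eqxx mul1r big1 ?addr0 // => x.
by rewrite eq_sym => /negbTE ->; rewrite mul0r.
Qed.

End WeightedActions.

(** The permutational wreath product of Z by the symmetric group of [X]: the bijections of [X * Z]
    that commute with the translations of Z and permute the fibres. *)
Definition wreath (X : finType) : Type := ({perm X} * {ffun X -> int})%type.

Section Wreath.
Variable X : finType.
Implicit Types a b c : wreath X.

HB.instance Definition _ := Choice.on (wreath X).

(* The factors of the permutation parts are swapped because permutations
   compose from left to right. *)
Definition wreath_mul a b : wreath X :=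
  (b.1 * a.1, [ffun x => (b.2 x + a.2 (b.1 x))%R]).
Definition wreath_one : wreath X := (1, [ffun=> 0%R]).
Definition wreath_inv a : wreath X :=
  (a.1^-1, [ffun x => (- a.2 ((a.1^-1)%g x))%R]).

Lemma wreathP a b :
  (forall x, a.1 x = b.1 x) -> (forall x, a.2 x = b.2 x) -> a = b.
Proof.
by case: a b => [p u] [q v] /= e e'; congr (_, _); [apply/permP|apply/ffunP].
Qed.

Lemma wreath_mulE a b x :
  ((wreath_mul a b).1 x = a.1 (b.1 x)) *
  ((wreath_mul a b).2 x = (b.2 x + a.2 (b.1 x))%R).
Proof. by rewrite permM ffunE. Qed.

Lemma wreath_oneE x : (wreath_one.1 x = x) * (wreath_one.2 x = 0%R).
Proof. by rewrite perm1 ffunE. Qed.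

Lemma wreath_invE a x :
  ((wreath_inv a).1 x = a.1^-1%g x) *
  ((wreath_inv a).2 x = (- a.2 (a.1^-1%g x))%R).
Proof. by rewrite ffunE. Qed.

Let wreathE := (wreath_mulE, wreath_oneE, wreath_invE).

Lemma wreath_mulA : associative wreath_mul.
Proof. by move=> a b c; apply: wreathP => x; rewrite !wreathE // addrA. Qed.

Lemma wreath_mul1 : left_id wreath_one wreath_mul.
Proof. by move=> a; apply: wreathP => x; rewrite !wreathE ?addr0. Qed.

Lemma wreath_1mul : right_id wreath_one wreath_mul.
Proof. by move=> a; apply: wreathP => x; rewrite !wreathE ?add0r. Qed.

Lemma wreath_mulV : left_inverse wreath_one wreath_inv wreath_mul.
Proof. by move=> a; apply: wreathP => x; rewrite !wreathE permK ?subrr. Qed.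

Lemma wreath_Vmul : right_inverse wreath_one wreath_inv wreath_mul.
Proof. by move=> a; apply: wreathP => x; rewrite !wreathE ?permKV ?addNr. Qed.

HB.instance Definition _ := isGroup.Build (wreath X)
  wreath_mulA wreath_mul1 wreath_1mul wreath_mulV wreath_Vmul.

(** With its converse [wreath_waction], it turns weighted actions into homomorphisms, to which the
    universal property of the amalgam applies. *)
Lemma wreath_hom (H : groupType) f w : @weighted_action H X f w ->
  exists F : group_hom H (wreath X),
    forall h x, (F h).1 x = f h x /\ (F h).2 x = w h x.
Proof.
move=> fw; have [f1 fM wM] := fw.
have [|F FE] := @group_homP H (wreath X)
    (fun h => (perm (@waction_inj _ _ _ _ fw h), [ffun x => w h x])).
  by move=> g h; apply: wreathP => x; rewrite !wreath_mulE !(permE, ffunE).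
exists F => h x; rewrite FE; split; first exact: permE.
exact: ffunE.
Qed.

Lemma wreath_waction (H : groupType) (F : group_hom H (wreath X)) :
  weighted_action (fun h => (F h).1) (fun h => (F h).2).
Proof.
split=> [x|g h x|g h x]; rewrite ?gmulf1 ?gmulfM ?wreath_mulE //.
exact: (wreath_oneE x).1.
Qed.

End Wreath.

(** * Gluing weighted actions along the amalgamated subgroup *)

Section Glue.
Variables (C G1 G2 G : groupType).
Variables (i1 : group_hom C G1) (i2 : group_hom C G2).
Variables (j1 : group_hom G1 G) (j2 : group_hom G2 G).
Hypothesis amalgam : is_amalgamated_product i1 i2 j1 j2.

(** The action on [X * Z] is conjugated by [(x, k) |-> (theta x, k + beta x)]. *)
Lemma waction_conj (H : groupType) (X : finType) f w (theta theta' : X -> X)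
    (beta : X -> int) :
  @weighted_action H X f w -> cancel theta theta' -> cancel theta' theta ->
  @weighted_action H X (fun h x => theta' (f h (theta x)))
    (fun h x => (beta x + w h (theta x) - beta (theta' (f h (theta x))))%R).
Proof.
move=> [f1 fM wM] tK tK'; split=> [x|g h x|g h x]; first by rewrite f1 tK.
  by rewrite fM tK'.
by rewrite wM tK' fM; ring.
Qed.

(** The last two premises say that [(x, k) |-> (theta x, k + beta x)] is [C]-equivariant; after
    conjugating the action of [G2] by it, both actions agree on [C]. *)
Lemma glue_wactions (X : finType) fA wA fB wB (theta theta' : X -> X)
    (beta : X -> int) :
  @weighted_action G1 X fA wA -> @weighted_action G2 X fB wB ->
  cancel theta theta' -> cancel theta' theta ->
  (forall u x, theta (fA (i1 u) x) = fB (i2 u) (theta x)) ->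
  (forall u x, (wA (i1 u) x + beta (fA (i1 u) x)
    = beta x + wB (i2 u) (theta x))%R) ->
  exists f w, [/\ @weighted_action G X f w,
    forall a x, f (j1 a) x = fA a x /\ w (j1 a) x = wA a x &
    forall b x, f (j2 b) x = theta' (fB b (theta x)) /\
      w (j2 b) x
        = (beta x + wB b (theta x) - beta (theta' (fB b (theta x))))%R].
Proof.
move=> actA actB tK tK' fC wC.
have [F1 F1E] := wreath_hom actA.
have [F2 F2E] := wreath_hom (waction_conj beta actB tK tK').
have [_ _ _ univ] := amalgam.
have [|F [FA FB _]] := univ _ F1 F2.
  move=> u; apply: wreathP => x /=.
    by rewrite (F1E _ _).1 (F2E _ _).1 -fC tK.
  by rewrite (F1E _ _).2 (F2E _ _).2 -fC tK -wC addrK.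
exists (fun h => (F h).1), (fun h => (F h).2); split.
- exact: wreath_waction.
- by move=> a x; have := F1E a x; rewrite -FA.
- by move=> b x; have := F2E b x; rewrite -FB.
Qed.

End Glue.

(** * Normal forms in amalgamated products *)

Section SubgroupType.
Variables (G : groupType) (H : set G).

Definition subgroup_type of subgroup H : Type := {x : G | x \in H}.

Variable sH : subgroup H.

HB.instance Definition _ := SubChoice.on (subgroup_type sH).
HB.instance Definition _ :=
  SubChoice_isSubGroup.Build G [in H] (subgroup_type sH) sH.

End SubgroupType.

Section Amalgam.
Variables (C G1 G2 G : groupType).
Variables (i1 : group_hom C G1) (i2 : group_hom C G2).
Variables (j1 : group_hom G1 G) (j2 : group_hom G2 G).
Hypothesis amalgam : is_amalgamated_product i1 i2 j1 j2.

Lemma amalgam_sym : is_amalgamated_product i2 i1 j2 j1.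
Proof.
have [inj1 inj2 j12 univ] := amalgam; split=> // T f1 f2 f12.
have [|f [fj1 fj2 f_uniq]] := univ T f2 f1; first by move=> u; rewrite f12.
by exists f; split=> // f' e1 e2; apply: f_uniq.
Qed.

(** The universal property maps [G] to [H] over [j1] and [j2]; followed by the inclusion, this map
    is the identity of [G] by uniqueness. *)
Lemma amalgam_generated (H : set G) : subgroup H ->
  (forall a, H (j1 a)) -> (forall b, H (j2 b)) -> forall g, H g.
Proof.
move=> sH H1 H2 g; have [_ _ j12 univ] := amalgam.
have mem1 a : j1 a \in H by rewrite inE.
have mem2 b : j2 b \in H by rewrite inE.
pose T : groupType := subgroup_type sH.
have lift (K : groupType) (j : group_hom K G) : (forall a, j a \in H) ->
    exists F : group_hom K T, forall a, val (F a) = j a.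
  move=> jH; pose F0 a : T := exist _ (j a) (jH a).
  have [|F FE] := group_homP (f := F0); last by exists F => a; rewrite FE.
  by move=> x y; apply: val_inj; rewrite valM /= gmulfM.
have [F1 F1E] := lift _ j1 mem1; have [F2 F2E] := lift _ j2 mem2.
have [|f [fj1 fj2 _]] := univ T F1 F2.
  by move=> u; apply: val_inj; rewrite /= F1E F2E; apply: j12.
have [|vf vfE] := @group_homP G G (fun x => val (f x)).
  by move=> x y; rewrite gmulfM valM.
have [|idG idE] := @group_homP G G id; first by [].
have [f0 [_ _ uniq]] := univ G j1 j2 j12.
have vf1 : vf \o j1 =1 j1.
  by move=> a; rewrite /= vfE [f (j1 a)]fj1 F1E.
have vf2 : vf \o j2 =1 j2.
  by move=> b; rewrite /= vfE [f (j2 b)]fj2 F2E.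
have <- : vf g = g.
  rewrite (uniq vf vf1 vf2) -(uniq idG) ?idE // => x; by rewrite /= idE.
by rewrite vfE; have := valP (f g); rewrite inE.
Qed.

Definition pairs_prod (p : seq (G1 * G2)) : G :=
  \prod_(x <- p) (j1 x.1 * j2 x.2).

Lemma pairs_prod_cat p q : pairs_prod (p ++ q) = pairs_prod p * pairs_prod q.
Proof. exact: big_cat. Qed.

Lemma pairs_prod_cons a b q :
  pairs_prod ((a, b) :: q) = j1 a * j2 b * pairs_prod q.
Proof. exact: big_cons. Qed.

Lemma pairs_prod_nil : pairs_prod [::] = 1.
Proof. exact: big_nil. Qed.

Lemma pairs_prod_surj g : exists p, g = pairs_prod p.
Proof.
pattern g; apply: amalgam_generated => [|a|b]; last 2 first.
- by exists [:: (a, 1)]; rewrite pairs_prod_cons pairs_prod_nil gmulf1 !mulg1.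
- by exists [:: (1, b)]; rewrite pairs_prod_cons pairs_prod_nil gmulf1 mulg1 mul1g.
apply/subgroupP; split=> [|_ _ [p ->] [q ->]|_ [p ->]].
- by exists [::]; rewrite pairs_prod_nil.
- by exists (p ++ q); rewrite pairs_prod_cat.
elim: p => [|[a b] p [q eq]]; first by exists [::]; rewrite pairs_prod_nil invg1.
exists (q ++ [:: (1, b^-1); (a^-1, 1)]).
rewrite pairs_prod_cons pairs_prod_cat !pairs_prod_cons pairs_prod_nil -eq.
by rewrite !gmulf1 !mulg1 mul1g !invgM !gmulfV.
Qed.

Definition reduced_pairs (p : seq (G1 * G2)) : Prop :=
  forall x, x \in p -> forall u, x.1 <> i1 u /\ x.2 <> i2 u.

(** Induction on the number of pairs: a pair with an entry from [C] is rotated to the front by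
    conjugation, collapses into one factor and is absorbed by a cyclic neighbour. *)
Lemma conj_cyclically_reduced g : exists h,
  [\/ exists a, g = h * j1 a * h^-1, exists b, g = h * j2 b * h^-1 |
      exists p, [/\ p <> [::], reduced_pairs p & g = h * pairs_prod p * h^-1]].
Proof.
have [p eg] := pairs_prod_surj g.
have {eg} : exists h, g = h * pairs_prod p * h^-1.
  by exists 1; rewrite mul1g invg1 mulg1.
have [n] := ubnP (size p); elim: n p => // n IHn p sz_p [h eg].
have [p0|p0] := pselect (p = [::]).
  exists h; apply: Or31; exists 1.
  by rewrite eg p0 pairs_prod_nil gmulf1.
have [[x [xp bad]]|good] :=
    pselect (exists x, x \in p /\ exists u, x.1 = i1 u \/ x.2 = i2 u); last first.
  exists h; apply: Or33; exists p; split=> // x xp u.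
  by split=> e; apply: good; exists x; split=> //; exists u; [left|right].
case/splitPr: xp p0 sz_p eg => p1 p2 _; rewrite size_cat /= => sz_p eg.
have {}eg : exists h', g = h' * (j1 x.1 * j2 x.2 * pairs_prod (p2 ++ p1)) * h'^-1.
  exists (h * pairs_prod p1); rewrite eg; case: x {bad eg} => a b.
  rewrite !pairs_prod_cat pairs_prod_cons invgM !mulgA.
  by rewrite -[_ * pairs_prod p1 * (pairs_prod p1)^-1]mulgA mulgV mulg1.
have {}sz_p : (size (p2 ++ p1) < n)%N
  by rewrite size_cat addnC; move: sz_p; rewrite addnS.
move: (p2 ++ p1) sz_p eg => q sz_q [{}h eg];
case: x bad eg => a b [u /= [->|->]] eg.
  (* The pair collapses into [G2], so it moves cyclically to the end and joins the last pair of
     [q]. *)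
  have {}eg : g = h * (j2 (i2 u * b) * pairs_prod q) * h^-1.
    by have [_ _ j12 _] := amalgam; rewrite eg [j1 (i1 u)]j12 [in RHS]gmulfM.
  case: (lastP q) sz_q eg => [|q' [a' b']] sz_q eg.
    by exists h; apply: Or32; exists (i2 u * b); rewrite eg pairs_prod_nil mulg1.
  apply: (IHn (rcons q' (a', b' * (i2 u * b))));
    first by move: sz_q; rewrite !size_rcons.
  exists (h * j2 (i2 u * b)); rewrite eg -!cats1 !pairs_prod_cat !pairs_prod_cons.
  rewrite pairs_prod_nil !mulg1 invgM [j2 (b' * _)]gmulfM !mulgA.
  by rewrite -[_ * j2 (i2 u * b) * (j2 (i2 u * b))^-1]mulgA mulgV mulg1.
(* The pair collapses into [G1] and joins the first pair of [q]. *)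
have {}eg : g = h * (j1 (a * i1 u) * pairs_prod q) * h^-1.
  by have [_ _ j12 _] := amalgam;
  rewrite eg [j2 (i2 u)](esym (j12 u)) [in RHS]gmulfM.
case: q sz_q eg => [|[a' b'] q'] sz_q eg.
  by exists h; apply: Or31; exists (a * i1 u); rewrite eg pairs_prod_nil mulg1.
apply: (IHn ((a * i1 u * a', b') :: q')) => //.
by exists h; rewrite eg !pairs_prod_cons [j1 (_ * a')]gmulfM !mulgA.
Qed.

End Amalgam.

(** * Equivariant bijections *)

(** Writing [x = p (d x) * rep x] with an orbit representative, [d x] is a coordinate of [x] in its
    orbit, determined only modulo the kernel of [p]. *)
Lemma equivariant_section (H : groupType) (Q : finGroupType) (p : group_hom H Q) :
  exists d : Q -> H, forall h x, p (d (p h * x)) = p h * p (d x).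
Proof.
pose rep x := xget 1 [set y | exists h, x = p h * y].
have repE h x : rep (p h * x) = rep x.
  rewrite /rep; congr (xget _ _); apply/seteqP; split=> y /= [k e].
    by exists (h^-1 * k); rewrite gmulfM gmulfV -mulgA -e mulKg.
  by exists (h * k); rewrite e gmulfM mulgA.
have repP x : exists h, x = p h * rep x.
  apply: (@xgetPex _ 1 [set y | exists h, x = p h * y]).
  by exists x, 1; rewrite gmulf1 mul1g.
exists (fun x => xget 1 [set h | x = p h * rep x]) => h x.
have dP y : y = p (xget 1 [set h | y = p h * rep y]) * rep y.
  exact: (xgetPex 1 (repP y)).
apply: (mulIg (rep x)); rewrite -[RHS]mulgA -dP -(repE h x).
by rewrite -dP.
Qed.

(** As for an induced representation, [alpha h x] is [phi] of the kernel element
    [(d (p h * x))^-1 * h * d x]. *)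
Lemma induced_cocycle (H : groupType) (Q : finGroupType) (p : group_hom H Q)
    (phi : H -> int) :
  (forall x y, p x = 1 -> p y = 1 -> phi (x * y) = (phi x + phi y)%R) ->
  exists alpha : H -> Q -> int,
    (forall g h x, alpha (g * h) x = (alpha h x + alpha g (p h * x)%g)%R) /\
    exists x, forall h, p h = 1 -> alpha h x = phi h.
Proof.
move=> phiD; have [d dE] := equivariant_section p.
pose alpha h x := phi ((d (p h * x))^-1 * h * d x).
have ker_alpha h x : p ((d (p h * x))^-1 * h * d x) = 1.
  by rewrite !gmulfM gmulfV dE invgM mulgVK mulVg.
exists alpha; split.
  move=> g h x; rewrite addrC /alpha -phiD ?ker_alpha //; congr phi.
  by rewrite !mulgA mulgK gmulfM.
(* At the point [(p (d 1))^-1] the value of [d] lies in the kernel, and conjugation by it does not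
   change [phi]. *)
have pd : p (d (p (d 1))^-1) = 1.
  by rewrite -[in LHS](mulg1 (p (d 1))^-1) -gmulfV dE gmulfV mulVg.
have phi1 : phi 1 = 0%R.
  have p1 : p 1 = 1 by exact: gmulf1.
   have := phiD 1 1 p1 p1; rewrite mulg1 => /eqP.
  by rewrite eq_sym -subr_eq0 addrK => /eqP.
have phiV k : p k = 1 -> phi k^-1 = (- phi k)%R.
  move=> pk; apply: (addrI (phi k)).
  by rewrite -phiD ?mulgV ?phi1 ?subrr // gmulfV pk invg1.
exists (p (d 1))^-1 => h ph; rewrite /alpha ph mul1g.
move: (d _) pd => k pk; have pkV : p k^-1 = 1 by rewrite gmulfV pk invg1.
rewrite phiD ?phiD ?phiV //; last by rewrite gmulfM pkV ph mulg1.
by rewrite addrC addrA subrr add0r.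
Qed.

(* With [x = A u * s] and [y = B v * t], where [s] and [t] represent the
   [C]-orbits of [x] and [y], the map is
   [(A u * s, B v * t) |-> (A v * s, B u * t)]: it intertwines the actions of [C]
   on the first and on the second factor. *)
Section Swap.
Variables (C : groupType) (Q1 Q2 : finGroupType).
Variables (A : group_hom C Q1) (B : group_hom C Q2).
Hypothesis kerAB : forall u, A u = 1 <-> B u = 1.
Variables (d1 : Q1 -> C) (d2 : Q2 -> C).
Hypothesis d1E : forall u x, A (d1 (A u * x)) = A u * A (d1 x).
Hypothesis d2E : forall u y, B (d2 (B u * y)) = B u * B (d2 y).

Definition swap (z : Q1 * Q2) : Q1 * Q2 :=
  (A (d2 z.2 * (d1 z.1)^-1) * z.1, B (d1 z.1 * (d2 z.2)^-1) * z.2).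

Lemma eq_AB u v : A u = A v <-> B u = B v.
Proof.
have eqM (Q : finGroupType) (p : group_hom C Q) : p u = p v <-> p (u / v) = 1.
  rewrite gmulfM gmulfV; split=> [->|/divg1_eq //]; exact: mulgV.
by rewrite !eqM; apply: kerAB.
Qed.

Lemma swapK : involutive swap.
Proof.
move=> [x y]; rewrite /swap /=.
set v := d2 y; set u := d1 x.
have eA : A (d1 (A (v * u^-1) * x)) = A v by rewrite d1E -gmulfM mulgVK.
have eB : B (d2 (B (u * v^-1) * y)) = B u by rewrite d2E -gmulfM mulgVK.
have eA' : A (d2 (B (u * v^-1) * y)) = A u by apply/eq_AB.
have eB' : B (d1 (A (v * u^-1) * x)) = B v by apply/eq_AB.
congr (_, _).
  by rewrite [A (_ / d1 _)]gmulfM gmulfV eA' eA gmulfM gmulfV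
    !mulgA mulgVK mulgV mul1g.
by rewrite [B (_ / d2 _)]gmulfM gmulfV eB' eB gmulfM gmulfV
  !mulgA mulgVK mulgV mul1g.
Qed.

Lemma swap_equivariant u x y :
  swap (A u * x, y) = ((swap (x, y)).1, B u * (swap (x, y)).2).
Proof.
have eB : B (d1 (A u * x)) = B (u * d1 x).
  by apply/eq_AB; rewrite d1E gmulfM.
rewrite /swap /=; congr (_, _).
  by rewrite !gmulfM !gmulfV d1E invgM !mulgA mulgVK.
by rewrite !gmulfM eB gmulfM !mulgA.
Qed.

Variables (aA : C -> Q1 -> int) (aB : C -> Q2 -> int).
Hypothesis aAM : forall u v x, aA (u * v) x = (aA v x + aA u (A v * x)%g)%R.
Hypothesis aBM : forall u v y, aB (u * v) y = (aB v y + aB u (B v * y)%g)%R.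
Variables (F1 : Q1 -> int) (F2 : Q2 -> int).
Hypothesis balanced : forall n v s t, A n = 1 ->
  (F1 (A v * s)%g * aB n t = F2 (B v * t)%g * aA n s)%R.

(* The difference between translating along [u] after and before the swap,
   starting from the orbit representative. *)
Definition swap_weight (z : Q1 * Q2) : int :=
  let u := d1 z.1 in
  (F1 (swap z).1 * aB u ((B (d2 z.2))^-1 * z.2)%g
   - F2 z.2 * aA u ((A u)^-1 * z.1)%g)%R.

(** This is the premise on weights of [glue_wactions] for [theta = swap] and
    [beta = swap_weight]. *)
Lemma swap_weightE u x y :
  (F2 y * aA u x + swap_weight (A u * x, y)%g%g
   = swap_weight (x, y) + F1 (swap (x, y)).1 * aB u (swap (x, y)).2)%R.
Proof.
rewrite /swap_weight swap_equivariant /= d1E.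
set v := d2 y; set t := (B v)^-1 * y; set u' := d1 x; set s := (A u')^-1 * x.
have -> : (A u * A u')^-1 * (A u * x) = s by rewrite invgM !mulgA mulgVK.
(* [d1 (A u * x)] and [u * d1 x] differ by a kernel element [n], whose two contributions cancel by
   [balanced]. *)
have An : A ((u * u')^-1 * d1 (A u * x)) = 1.
  by rewrite gmulfM gmulfV d1E -gmulfM mulVg.
have Bn := (kerAB _).1 An.
rewrite -[d1 (A u * x)](mulVKg (u * u')).
move: (_ * d1 _) An Bn => n An Bn.
rewrite (aAM _ n) (aBM _ n) An Bn !mul1g aAM aBM.
have -> : A u' * s = x by rewrite mulVKg.
have -> : B (u' * v^-1) * y = B u' * t by rewrite gmulfM gmulfV -mulgA.
have := balanced v s t An.
have -> : B v * t = y by rewrite mulVKg.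
have -> : A v * s = A (v * u'^-1) * x by rewrite gmulfM gmulfV -mulgA.
move=> e; rewrite !mulrDr e; ring.
Qed.

End Swap.

(** * Equivariant bijections with prescribed values *)

Section EquivariantExtension.
Variables (C : groupType) (X : finType) (actA actB : C -> X -> X).
Hypothesis actB1 : forall x, actB 1 x = x.
Hypothesis actBM : forall u v x, actB (u * v) x = actB u (actB v x).
Hypothesis actB_free : forall u x y, actB u x = x -> actB u y = y.

(** [psi] exchanges [actB u z] and [actB u q] when the two orbits differ; it is well defined because
    all points have the same stabilizer. *)
Lemma orbit_exchange z q : exists psi psi' : X -> X,
  [/\ cancel psi psi', cancel psi' psi,
      forall u x, psi (actB u x) = actB u (psi x), psi z = q &
      forall x, (forall u, x <> actB u z) -> (forall u, x <> actB u q) ->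
        psi x = x].
Proof.
have actBK u x : actB u^-1 (actB u x) = x by rewrite -actBM mulVg actB1.
have actBVK u x : actB u (actB u^-1 x) = x by rewrite -actBM mulgV actB1.
have act_eq u v x y : actB u x = actB v x -> actB u y = actB v y.
  move=> e; have : actB (v^-1 * u) x = x by rewrite actBM e actBK.
  by move=> /(@actB_free _ _ y); rewrite actBM => e'; rewrite -[in RHS]e' actBVK.
pose orb y x := exists u, x = actB u y.
pose psi x := if pselect (orb z x) is left e then actB (projT1 (cid e)) q
  else if pselect (orb q x) is left e then actB (projT1 (cid e)) z else x.
have psiz u : psi (actB u z) = actB u q.
  rewrite /psi; case: pselect => [e|[]]; last by exists u.
  by case: (cid e) => v /= /esym/act_eq; apply.
have psiq u : ~ orb z (actB u q) -> psi (actB u q) = actB u z.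
  rewrite /psi; case: pselect => [e|_ _]; first by move=> /(_ e).
  case: pselect => [e|[]]; last by exists u.
  by case: (cid e) => v /= /esym/act_eq; apply.
have psi0 x : ~ orb z x -> ~ orb q x -> psi x = x.
  by rewrite /psi; do 2![case: pselect => //].
have orbM y u x : orb y (actB u x) <-> orb y x.
  split=> [[v e]|[v ->]]; last by exists (u * v); rewrite actBM.
  by exists (u^-1 * v); rewrite actBM -e actBK.
have orb_sym x y : orb x y -> orb y x.
  by move=> [u ->]; exists u^-1; rewrite actBK.
have orb_refl x : orb x x by exists 1; rewrite actB1.
have psi_eq u x : psi (actB u x) = actB u (psi x).
  have [[v ->]|nz] := pselect (orb z x); first by rewrite -actBM !psiz actBM.
  have nzu : ~ orb z (actB u x) by rewrite orbM.
  have [[v ex]|nq] := pselect (orb q x); last by rewrite !psi0 // orbM.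
  by move: nz nzu; rewrite ex -actBM => nz nzu; rewrite !psiq // actBM.
have psiK x : ~ orb z q -> psi (psi x) = x.
  move=> nzq; have nqz : ~ orb q z by move=> /orb_sym.
  have [[v ->]|nz] := pselect (orb z x).
    by rewrite psiz psiq // orbM.
  have [[v ex]|nq] := pselect (orb q x); last by rewrite !psi0.
  by move: nz; rewrite ex => nz; rewrite psiq // psiz.
have psi_inj : injective psi.
  (* When [z] and [q] share an orbit, [psi] need not be an involution, and injectivity is checked
     directly. *)
  have [zq|nzq] := pselect (orb z q); last first.
    by apply: (can_inj (g := psi)) => x; apply: psiK.
  have outside x : ~ orb z x -> psi x = x.
    move=> nz; apply: psi0 => // -[u ex]; apply: nz.
    by rewrite ex orbM.
  have inside u : orb z (actB u q) by rewrite orbM.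
  move=> x y.
  have [[u ->]|nx] := pselect (orb z x); have [[v ->]|ny] := pselect (orb z y).
  - by rewrite !psiz => /act_eq.
  - by rewrite psiz outside // => e; case: ny; rewrite -e.
  - by rewrite psiz outside // => e; case: nx; rewrite e.
  - by rewrite !outside.
exists psi, (invF psi_inj); split=> //.
- exact: invF_f.
- exact: f_invF.
- by have := psiz 1; rewrite !actB1.
- by move=> x nz nq; apply: psi0 => -[u ex]; [apply: (nz u)|apply: (nq u)].
Qed.

(** Values are corrected one at a time: exchanging the orbits of [eta (p j)] and [q j] preserves the
    earlier values, which lie in other orbits. *)
Lemma extend_equivariant (J : eqType) (p q : J -> X) (theta theta' : X -> X)
    (s : seq J) :
    cancel theta theta' -> cancel theta' theta ->
    (forall u x, theta (actA u x) = actB u (theta x)) ->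
    (forall i j u, i != j -> p j <> actA u (p i)) ->
    (forall i j u, i != j -> q j <> actB u (q i)) ->
  exists eta eta', [/\ cancel eta eta', cancel eta' eta,
    forall u x, eta (actA u x) = actB u (eta x) &
    forall j, j \in s -> eta (p j) = q j].
Proof.
move=> tK tK' t_eq p_dis q_dis.
elim: s => [|j s [eta [eta' [eK eK' e_eq es]]]]; first by exists theta, theta'.
have [js|js] := boolP (j \in s).
  by exists eta, eta'; split=> // i; rewrite inE => /predU1P[->|]; apply: es.
have [psi [psi' [pK pK' p_eq pj p0]]] := orbit_exchange (eta (p j)) (q j).
exists (psi \o eta), (eta' \o psi'); split.
- exact: can_comp.
- exact: can_comp.
- by move=> u x /=; rewrite e_eq p_eq.
move=> i; rewrite inE => /predU1P[->//|i_s] /=.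
have ji : j != i by apply: contraNneq js => ->.
rewrite es // p0 // => u; last exact: q_dis.
by rewrite -es // -e_eq => /(can_inj eK); apply: p_dis.
Qed.

End EquivariantExtension.

(** * Elliptic elements *)

Section Cocycles.
Variables (H : groupType) (Q : finGroupType) (p : group_hom H Q).
Variable alpha : H -> Q -> int.
Hypothesis alphaM : forall g h x,
  alpha (g * h) x = (alpha h x + alpha g (p h * x)%g)%R.

Lemma cocycle1 x : alpha 1 x = 0%R.
Proof.
have := alphaM 1 1 x; rewrite mulg1 gmulf1 mul1g => /eqP.
by rewrite eq_sym -subr_eq0 addrK => /eqP.
Qed.

Lemma cocycle_ker x : zhom_on [set h | p h = 1] (alpha^~ x).
Proof. by move=> g h _ /= ph; rewrite alphaM ph mul1g addrC. Qed.

Lemma cocycle_conj n v x : p n = 1 ->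
  alpha (v^-1 * n * v) x = alpha n (p v * x).
Proof.
move=> pn; rewrite !alphaM pn mul1g.
have := alphaM v^-1 v x; rewrite mulVg cocycle1 => /esym/eqP.
by rewrite addrCA => /eqP ->; rewrite addr0.
Qed.

End Cocycles.

Section AmalgamRetracts.
Variables (C G1 G2 G : groupType).
Variables (i1 : group_hom C G1) (i2 : group_hom C G2).
Variables (j1 : group_hom G1 G) (j2 : group_hom G2 G).
Hypothesis amalgam : is_amalgamated_product i1 i2 j1 j2.

Section Product.
Variables (Q1 Q2 : finGroupType) (p1 : group_hom G1 Q1) (p2 : group_hom G2 Q2).
Hypothesis ker12 : forall u, p1 (i1 u) = 1 <-> p2 (i2 u) = 1.

Lemma exists_swap : exists (A : group_hom C Q1) (B : group_hom C Q2) d1 d2,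
  [/\ (forall u, A u = p1 (i1 u)) /\ (forall u, B u = p2 (i2 u)),
      forall u, A u = 1 <-> B u = 1,
      forall u x, A (d1 (A u * x)) = A u * A (d1 x) &
      forall u x, B (d2 (B u * x)) = B u * B (d2 x)].
Proof.
have [A AE] := hom_comp i1 p1; have [B BE] := hom_comp i2 p2.
have [d1 d1E] := equivariant_section A; have [d2 d2E] := equivariant_section B.
exists A, B, d1, d2; split=> // u; rewrite AE BE; exact: ker12.
Qed.

(** [G1] and [G2] act on one factor each and the swap glues them. The conclusion describes [j1]
    only, elliptic elements of [G2] being reached through [amalgam_sym]. *)
Lemma glue_product (alpha1 : G1 -> Q1 -> int) (alpha2 : G2 -> Q2 -> int)
    (F1 : Q1 -> int) (F2 : Q2 -> int) :
  (forall g h x, alpha1 (g * h) x = (alpha1 h x + alpha1 g (p1 h * x)%g)%R) ->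
  (forall g h x, alpha2 (g * h) x = (alpha2 h x + alpha2 g (p2 h * x)%g)%R) ->
  (forall n v s t, p1 (i1 n) = 1 ->
    (F1 (p1 (i1 v) * s)%g * alpha2 (i2 n) t
     = F2 (p2 (i2 v) * t)%g * alpha1 (i1 n) s)%R) ->
  exists f w, @weighted_action G (Q1 * Q2)%type f w /\
    forall a x y, f (j1 a) (x, y) = (p1 a * x, y) /\
      w (j1 a) (x, y) = (F2 y * alpha1 a x)%R.
Proof.
move=> alpha1M alpha2M bal.
have [A [B [d1 [d2 [[AE BE] kerAB d1E d2E]]]]] := exists_swap.
pose fA g (z : Q1 * Q2) := (p1 g * z.1, z.2).
pose wA g (z : Q1 * Q2) := (F2 z.2 * alpha1 g z.1)%R.
pose fB g (z : Q1 * Q2) := (z.1, p2 g * z.2).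
pose wB g (z : Q1 * Q2) := (F1 z.1 * alpha2 g z.2)%R.
have actA : weighted_action fA wA.
  split=> [[x y]|g h [x y]|g h z]; rewrite /fA /wA /=.
  - by rewrite gmulf1 mul1g.
  - by rewrite gmulfM mulgA.
  - by rewrite alpha1M mulrDr.
have actB : weighted_action fB wB.
  split=> [[x y]|g h [x y]|g h z]; rewrite /fB /wB /=.
  - by rewrite gmulf1 mul1g.
  - by rewrite gmulfM mulgA.
  - by rewrite alpha2M mulrDr.
have sK := swapK kerAB d1E d2E.
pose beta := swap_weight A B d1 d2 (fun u => alpha1 (i1 u))
               (fun u => alpha2 (i2 u)) F1 F2.
have [u [x y]|u [x y]|f [w [fw fwA _]]] :=
  glue_wactions (beta := beta) amalgam actA actB sK sK.
- by rewrite /fA /fB /= -AE -BE; apply: swap_equivariant.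
- rewrite /fA /fB /wA /wB /= -AE; apply: swap_weightE => //.
  + by move=> v v' s; rewrite gmulfM alpha1M AE.
  + by move=> v v' s; rewrite gmulfM alpha2M BE.
  + by move=> n v s t An; rewrite AE BE bal // -AE.
by exists f, w; split=> // a x y; apply: fwA.
Qed.

End Product.

Hypotheses (V1 : VRC G1) (V2 : VRC G2) (vcC : virtually_cyclic C).

(** With [ker p1] inside [M], an element of [<j1 a>] acting trivially on [Q1 * Q2] is trivial; the
    weights are set to 0. *)
Lemma torsion_elliptic_retract a n : (0 < n)%N -> a ^+ n = 1 ->
  virtual_retract (cyclic_subgroup (j1 a)).
Proof.
move=> n0 an; have [inj1 inj2 _ _] := amalgam.
have [c [r [infc rP]]] := infinite_or_trivial_reps V1 inj1 vcC.
have [M fM Ma] := VRC_torsion V1 n0 an.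
have [//|//|m [Q1 [Q2 [p1 [p2 [_ [pM _] [k1 k2] _ _]]]]]] :=
  compatible_quotients (S1 := [::]) (S2 := [::]) V1 V2 inj1 inj2
    infc rP fM (fiT G2).
have ker12 u : p1 (i1 u) = 1 <-> p2 (i2 u) = 1 by rewrite k1 k2.
have [|||f [w [fw fE]]] := glue_product ker12 (alpha1 := fun _ _ => 0%R)
  (alpha2 := fun _ _ => 0%R) (F1 := fun _ => 0%R) (F2 := fun _ => 0%R) => //.
have [f1 fMul _] := fw.
apply: (@separated_virtual_retract _ _ [set h | forall z, f h z = z]).
  apply: (waction_ker_fi fw) => //;
  apply/subgroupP; split=> // [x y ex ey z|x ex z].
    by rewrite fMul ey ex.
  by rewrite -{1}(ex z) -fMul mulVg f1.
move=> z /(_ (1, 1)); rewrite -hom_zexpg (fE _ _ _).1 => -[].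
by rewrite mulg1 => /pM/Ma ->; rewrite gmulf1.
Qed.

Lemma infinite_elliptic_retract a : infinite_order a ->
  virtual_retract (cyclic_subgroup (j1 a)).
Proof.
move=> infa; have [inj1 inj2 _ _] := amalgam.
have [c [r [infc rP]]] := infinite_or_trivial_reps V1 inj1 vcC.
have [K1 [phi1 [fK1 phi1M K1a phi1a]]] := VRC_zhom V1 infa.
suff [Q1 [Q2 [p1 [p2 [alpha1 [alpha2 [F1 [F2 [y2 [[ker12 pK] alpha1M alpha2M bal
    [F2y [x1 alpha1x]]]]]]]]]]]] :
  exists (Q1 Q2 : finGroupType) (p1 : group_hom G1 Q1) (p2 : group_hom G2 Q2)
    (alpha1 : G1 -> Q1 -> int) (alpha2 : G2 -> Q2 -> int)
    (F1 : Q1 -> int) (F2 : Q2 -> int) (y2 : Q2), [/\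
    (forall u, p1 (i1 u) = 1 <-> p2 (i2 u) = 1) /\ (forall h, p1 h = 1 -> K1 h),
    forall g h x, alpha1 (g * h) x = (alpha1 h x + alpha1 g (p1 h * x)%g)%R,
    forall g h x, alpha2 (g * h) x = (alpha2 h x + alpha2 g (p2 h * x)%g)%R,
    forall n v s t, p1 (i1 n) = 1 ->
      (F1 (p1 (i1 v) * s)%g * alpha2 (i2 n) t
       = F2 (p2 (i2 v) * t)%g * alpha1 (i1 n) s)%R &
    F2 y2 <> 0%R /\ exists x1, forall h, p1 h = 1 -> alpha1 h x1 = phi1 h].
  have [f [w [fw fE]]] := glue_product ker12 alpha1M alpha2M bal.
  (* This power of [a] fixes [(x1, y2)] and translates its fibre by [F2 y2 * #[p1 a]]. *)
  have pan : p1 (a ^+ #[p1 a]) = 1 by rewrite gmulfXn expg_order.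
  have := weighted_virtual_retract fw (g := j1 a) (n := #[p1 a]) (x0 := (x1, y2)).
  rewrite -!gmulfXn (fE _ _ _).1 (fE _ _ _).2 pan mul1g alpha1x //.
  rewrite (zhomXn _ fK1.1 phi1M K1a).2 phi1a; apply=> //; apply/eqP.
  by rewrite mulf_neq0 //; [apply/eqP|rewrite pnatr_eq0 -lt0n order_gt0].
have [infc' | c1] : infinite_order c \/ c = 1 by case: infc; [right|left].
  have inf2 : infinite_order (i2 c).
    have i21 : i2 1 = 1 by exact: gmulf1.
    by move=> n; rewrite -gmulfXn -i21 => /inj2/infc'.
  have [K2 [phi2 [fK2 phi2M K2c phi2c]]] := VRC_zhom V2 inf2.
  have [//|//|m [Q1 [Q2 [p1 [p2 [m0 [pK1 pK2] [k1 k2] _ _]]]]]] :=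
    compatible_quotients (S1 := [::]) (S2 := [::]) V1 V2 inj1 inj2 infc rP fK1 fK2.
  have ker12 u : p1 (i1 u) = 1 <-> p2 (i2 u) = 1 by rewrite k1 k2.
  have [|alpha1 [alpha1M [x1 alpha1x]]] := @induced_cocycle _ _ p1 phi1.
    by move=> x y /pK1 Kx /pK1 Ky; apply: phi1M.
  have [|alpha2 [alpha2M [x2 alpha2x]]] := @induced_cocycle _ _ p2 phi2.
    by move=> x y /pK2 Kx /pK2 Ky; apply: phi2M.
  pose c0 := zexpg c m.
  have pc0 : p1 (i1 c0) = 1 by apply/k1; exists 1%R; rewrite mulr1.
  have pc0' : p2 (i2 c0) = 1 by apply/ker12.
  exists Q1, Q2, p1, p2, alpha1, alpha2, (alpha1 (i1 c0)), (alpha2 (i2 c0)), x2.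
  split=> //; last first.
    split; last by exists x1.
    rewrite alpha2x // hom_zexpg.
    by have [_ ->] := zhom_zexpg m fK2.1 phi2M K2c; rewrite phi2c mul1r; lia.
  have c0k u : p1 (i1 u) = 1 -> exists k, u = zexpg c0 k.
    by move=> /k1[k ->]; exists k; rewrite zexpgM.
  have a1k k s : alpha1 (i1 (zexpg c0 k)) s = (alpha1 (i1 c0) s * k)%R.
    rewrite hom_zexpg.
    by have [_ ->] := zhom_zexpg k (ker_fi p1).1 (cocycle_ker alpha1M s) pc0.
  have a2k k t : alpha2 (i2 (zexpg c0 k)) t = (alpha2 (i2 c0) t * k)%R.
    rewrite hom_zexpg.
    by have [_ ->] := zhom_zexpg k (ker_fi p2).1 (cocycle_ker alpha2M t) pc0'.
  (* With [n = c0 ^ k] and [v^-1 * c0 * v = c0 ^ l], both sides equal [l * k] times the product of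
     the values of [alpha1] at [(c0, s)] and [alpha2] at [(c0, t)]. *)
  move=> n v s t /c0k[k ->].
  rewrite -(cocycle_conj alpha1M) // -(cocycle_conj alpha2M) //.
  rewrite -!gmulfV -!gmulfM.
  have [|l ->] := c0k (v^-1 * c0 * v).
    by rewrite !gmulfM pc0 mulg1 -!gmulfM mulVg !gmulf1.
  by rewrite !a1k !a2k; ring.
have [//|//|m [Q1 [Q2 [p1 [p2 [m0 [pK1 _] [k1 k2] _ _]]]]]] :=
  compatible_quotients (S1 := [::]) (S2 := [::]) V1 V2 inj1 inj2
    infc rP fK1 (fiT G2).
have ker12 u : p1 (i1 u) = 1 <-> p2 (i2 u) = 1 by rewrite k1 k2.
have [|alpha1 [alpha1M [x1 alpha1x]]] := @induced_cocycle _ _ p1 phi1.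
  by move=> x y /pK1 Kx /pK1 Ky; apply: phi1M.
(* For [c = 1] the kernels meet [C] trivially, so the balance condition concerns only [n = 1], and
   [G2] may act with weight 0. *)
exists Q1, Q2, p1, p2, alpha1, (fun _ _ => 0%R), (fun=> 0%R), (fun=> 1%R), 1.
split=> //; last by split; last by exists x1.
move=> n v s t /k1[k ->].
by rewrite c1 zexpg1n gmulf1 (cocycle1 alpha1M) !mulr0.
Qed.

Lemma elliptic_retract a : virtual_retract (cyclic_subgroup (j1 a)).
Proof.
case: (finite_or_infinite_order a) => [[n n0 an]|].
  exact: torsion_elliptic_retract an.
exact: infinite_elliptic_retract.
Qed.

End AmalgamRetracts.

(** * Hyperbolic elements *)

Section Hyperbolic.
Variables (C G1 G2 G : groupType).
Variables (i1 : group_hom C G1) (i2 : group_hom C G2).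
Variables (j1 : group_hom G1 G) (j2 : group_hom G2 G).
Hypothesis amalgam : is_amalgamated_product i1 i2 j1 j2.
Variables (Q1 Q2 : finGroupType) (p1 : group_hom G1 Q1) (p2 : group_hom G2 Q2).
Hypothesis ker12 : forall u, p1 (i1 u) = 1 <-> p2 (i2 u) = 1.

Lemma hyperbolic_retract (p : seq (G1 * G2)) : p <> [::] ->
    (forall x, x \in p -> forall u, p1 x.1 <> p1 (i1 u) /\ p2 x.2 <> p2 (i2 u)) ->
  virtual_retract (cyclic_subgroup (pairs_prod j1 j2 p)).
Proof.
move=> p0 pred.
have n0 : (0 < size p)%N by case: (p) p0.
set n := size p in n0.
pose X := (Q1 * Q2 * 'I_n)%type.
pose fA g (z : X) : X := (p1 g * z.1.1, z.1.2, z.2).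
pose fB g (z : X) : X := (z.1.1, p2 g * z.1.2, z.2).
(* Both factors act with weight 0; all translations will come from [beta]. *)
pose w0 (H : groupType) (g : H) (z : X) : int := 0%R.
have actA : weighted_action fA (w0 G1).
  split=> [[[x y] i]|g h [[x y] i]|//]; rewrite /fA /=.
  - by rewrite gmulf1 mul1g.
  - by rewrite gmulfM mulgA.
have actB : weighted_action fB (w0 G2).
  split=> [[[x y] i]|g h [[x y] i]|//]; rewrite /fB /=.
  - by rewrite gmulf1 mul1g.
  - by rewrite gmulfM mulgA.
pose a_ (i : 'I_n) := p1 (nth (1, 1) p i).1.
pose b_ (i : 'I_n) := p2 (nth (1, 1) p i).2.
have aP i u : a_ i <> p1 (i1 u).
  by have /pred/(_ u)[] : nth (1, 1) p i \in p by apply: mem_nth.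
have bP i u : b_ i <> p2 (i2 u).
  by have /pred/(_ u)[] : nth (1, 1) p i \in p by apply: mem_nth.
pose exitA i : X := (a_ i, 1, i).
pose base i : X := (1, 1, i).
pose exitB i : X := (1, b_ i, i).
(* Once [theta] maps [src] to [tgt], [b_k] moves [exitA (k + 1)] to [base k],
   which [a_k] moves to [exitA k]: the product closes up after [n] steps. *)
pose src (k : 'I_n * bool) := if k.2 then base k.1 else exitA (ordS k.1).
pose tgt (k : 'I_n * bool) := if k.2 then exitB k.1 else base k.1.
have aV i u : p1 (i1 u) * a_ i <> 1.
  move=> /mulg1_eq e; apply: (aP i u^-1).
  by rewrite !gmulfV e.
have bV i u : p2 (i2 u) * b_ i <> 1.
  move=> /mulg1_eq e; apply: (bP i u^-1).
  by rewrite !gmulfV e.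
have src_dis i j u : i != j -> src j <> fA (i1 u) (src i).
  case: i j => [i [] [j []]] ij; rewrite /src /fA /= => -[].
  - by move=> _ e; rewrite e eqxx in ij.
  - by rewrite mulg1; move/aP.
  - by move/esym/aV.
  - move=> _ e; have {}e : j = i by apply: ordS_inj; apply: val_inj.
    by rewrite e eqxx in ij.
have tgt_dis i j u : i != j -> tgt j <> fB (i2 u) (tgt i).
  case: i j => [i [] [j []]] ij; rewrite /tgt /fB /= => -[].
  - by move=> _ e; rewrite e eqxx in ij.
  - by move/esym/bV.
  - by rewrite mulg1; move/bP.
  - by move=> _ e; rewrite e eqxx in ij.
have [A [B [d1 [d2 [[AE BE] kerAB d1E d2E]]]]] := exists_swap ker12.
(* The swap on each copy is the equivariant bijection that is then corrected on the points
   [src k]. *)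
pose theta0 (z : X) : X := (swap A B d1 d2 z.1, z.2).
have theta0K : involutive theta0.
  by move=> [z i]; rewrite /theta0 /= (swapK kerAB d1E d2E).
have theta0E u z : theta0 (fA (i1 u) z) = fB (i2 u) (theta0 z).
  case: z => [[x y] i]; rewrite /theta0 /fA /fB /= -AE -BE.
  by rewrite (swap_equivariant kerAB d2 d1E).
have B1 (x : X) : fB (i2 1) x = x.
  by rewrite gmulf1; case: actB.
have BM u v (x : X) : fB (i2 (u * v)) x = fB (i2 u) (fB (i2 v) x).
  by rewrite gmulfM; case: actB.
have Bfree u (x y : X) : fB (i2 u) x = x -> fB (i2 u) y = y.
  case: x y => [[x x'] i] [[y y'] j] [/eqP].
  by rewrite -{2}[x']mul1g (inj_eq (@mulIg _ _)) => /eqP e; rewrite /fB /= e mul1g.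
have [theta [theta' [tK tK' tE tP]]] :=
  extend_equivariant (actA := fun u => fA (i1 u)) B1 BM Bfree
    (enum {: 'I_n * bool}) theta0K theta0K theta0E src_dis tgt_dis.
have {}tP k : theta (src k) = tgt k by apply: tP; rewrite mem_enum.
pose i0 := Ordinal n0.
pose orb0 x := exists u, x = fA (i1 u) (exitA i0).
(* Being constant on [C]-orbits, [beta] meets the gluing premise; it charges 1 for leaving the orbit
   of [exitA i0]. *)
pose beta x : int := if pselect (orb0 x) then 1%R else 0%R.
have [_ fAM _] := actA.
have orb0E u x : orb0 (fA (i1 u) x) = orb0 x.
  apply/propext; split=> [[v e]|[v ->]].
    exists (u^-1 * v); rewrite gmulfM fAM -e -fAM -gmulfM mulVg gmulf1.
    by case: actA => ->.
  by exists (u * v); rewrite gmulfM fAM.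
have [|f [w [fw fE1 fE2]]] :=
  glue_wactions (beta := beta) amalgam actA actB tK tK' tE.
  by move=> u x; rewrite /beta orb0E /w0 add0r addr0.
pose idx k := Ordinal (ltn_pmod k n0).
have idxS k : idx k.+1 = ordS (idx k).
  by apply: val_inj; rewrite /= -addn1 -modnDml addn1.
have beta_base i : beta (base i) = 0%R.
  rewrite /beta; case: pselect => // bi; exfalso; case: bi => u [e _].
  by case: (aV i0 u).
have beta_exit k : (k < n)%N -> beta (exitA (idx k.+1)) = (k.+1 == n)%:R%R.
  move=> kn; rewrite /beta; have [kn'|kn'] := eqVneq k.+1 n.
    have -> : idx k.+1 = i0 by apply: val_inj; rewrite /= kn' modnn.
    case: pselect => // ne; case: ne; exists 1; rewrite gmulf1.
    by case: actA => ->.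
  case: pselect => // ek; exfalso; case: ek => u [_] /eqP.
  by rewrite modn_small // ltn_neqAle kn' kn.
have [fM wM] : (forall g h x, f (g * h) x = f g (f h x)) /\
    forall g h x, w (g * h) x = (w h x + w g (f h x))%R by case: fw.
have [f1 w1] : (forall x, f 1 x = x) /\ forall x, w 1 x = 0%R.
  case: (fw) => f1 _ _; split=> // x.
  have := wM 1 1 x; rewrite mulg1 f1 => /eqP.
  by rewrite eq_sym -subr_eq0 addrK => /eqP.
(* Indices are cyclic, so only the last pair, with [k.+1 = n], starts at [exitA i0] and gains weight
   1. *)
have step k : (k < n)%N -> let g := j1 (nth (1, 1) p k).1 * j2 (nth (1, 1) p k).2 in
    f g (exitA (idx k.+1)) = exitA (idx k) /\
    w g (exitA (idx k.+1)) = (k.+1 == n)%:R%R.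
  move=> kn /=.
  have e1 : theta (exitA (idx k.+1)) = base (idx k).
    by have := tP (idx k, false); rewrite /src /tgt /= -idxS.
  have e2 : theta' (fB (nth (1, 1) p k).2 (base (idx k))) = base (idx k).
    have <- : exitB (idx k) = fB (nth (1, 1) p k).2 (base (idx k)).
      by rewrite /exitB /fB /b_ /= modn_small // mulg1.
    by have := tP (idx k, true); rewrite /src /tgt /= => <-; rewrite tK.
  rewrite fM wM (fE2 _ _).1 (fE2 _ _).2 e1 e2 (fE1 _ _).1 (fE1 _ _).2.
  split; first by rewrite /exitA /fA /a_ /= modn_small // mulg1.
  by rewrite /w0 !addr0 beta_base subr0 beta_exit.
(* The rightmost pairs act first, so the induction runs over suffixes; the weight 1 is gained at the
   first step. *)
have path m : (m <= n)%N ->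
    f (pairs_prod j1 j2 (drop (n - m) p)) (exitA (idx n)) = exitA (idx (n - m)) /\
    w (pairs_prod j1 j2 (drop (n - m) p)) (exitA (idx n)) = (0 < m)%:R%R.
  elim: m => [_|m IHm mn]; first by rewrite subn0 drop_size pairs_prod_nil f1 w1.
  have [] := IHm (ltnW mn).
  have -> : (n - m = (n - m.+1).+1)%N by rewrite subnSK.
  have kn : (n - m.+1 < n)%N by rewrite ltn_subrL.
  move: (step _ kn) => /= [fs ws] fm wm.
  rewrite (drop_nth (1, 1)) //.
  case: (nth _ _ _) fs ws => a b /= fs ws.
  rewrite pairs_prod_cons fM wM fm wm fs ws; split=> //.
  by case: (m) mn => [|m'] mn; rewrite ?subnSK // ?subn0 ?eqxx //=;
    rewrite (_ : _ == n = false) ?addr0 //; lia.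
have [] := path n (leqnn n); rewrite subnn drop0 n0.
have -> : idx n = idx 0 by apply: val_inj; rewrite /= modnn mod0n.
move=> ef ew; apply: (weighted_virtual_retract fw (n := 1) (x0 := exitA (idx 0))).
  by rewrite expg1.
by rewrite expg1 ew.
Qed.

End Hyperbolic.

Theorem theorem1p3 (G0 G1 G2 G : groupType)
    (i1 : group_hom G0 G1) (i2 : group_hom G0 G2)
    (j1 : group_hom G1 G) (j2 : group_hom G2 G)
    (hG : is_amalgamated_product i1 i2 j1 j2)
    (hG0 : virtually_cyclic G0)
    (hG1 : VRC G1) (hG2 : VRC G2) :
  VRC G.
Proof.
move=> g; have [inj1 inj2 _ _] := hG.
have [h [[a ->]|[b ->]|[p [p0 p_red ->]]]] := conj_cyclically_reduced hG g;
  apply: virtual_retractJ.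
- exact: (elliptic_retract hG).
- exact: (elliptic_retract (amalgam_sym hG)).
have [c [r [infc rP]]] := infinite_or_trivial_reps hG1 inj1 hG0.
(* [S1] and [S2] list the entries of [p], so that they stay outside the image of [G0] in the finite
   quotients. *)
have [||m [Q1 [Q2 [p1 [p2 [_ _ [k1 k2] sep1 sep2]]]]]] := compatible_quotients
    (S1 := [seq x.1 | x <- p]) (S2 := [seq x.2 | x <- p])
    hG1 hG2 inj1 inj2 infc rP (fiT G1) (fiT G2).
- by move=> _ /mapP[x /p_red xp ->] u; case: (xp u).
- by move=> _ /mapP[x /p_red xp ->] u; case: (xp u).
have ker12 u : p1 (i1 u) = 1 <-> p2 (i2 u) = 1 by rewrite k1 k2.
apply: (hyperbolic_retract hG ker12) => // x xp u.
by split; [apply: sep1; apply: map_f|apply: sep2; apply: map_f].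
Qed.
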